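(* Consider the setting and algorithm described in the context, and let $W^k:=(x^k,y^k,z^k,u^k)$. Let $\gamma>0$ and $K_0\ge0$ be such that for all $k\ge K_0$: $\gamma_k=\gamma$, $\delta_k=\delta:=2\nu+L_{\nabla h}+\frac{2\|A\|^2}{\gamma}$ and $\|z^{k+1}\|\le\min\left(\frac{\varepsilon}{\gamma},\sqrt{\frac{2\varepsilon}{\gamma}}\right)$. Define $\Pi:\mathbb{R}^n\times\operatorname{dom}g^*\times\mathbb{R}^n\to\mathbb{R}\cup\{+\infty\}$ by $\Pi(x,z,u):=\Psi(x,z,u,\delta,\gamma)/f(Kx)$, and let $\Omega$ be the set of accumulation points of $\{W^k\}$. Then: (i) for $k\ge K_0+1$ one has $\theta_k=\Pi(x^k,z^k,u^k)$, the sequence $\{\theta_k\}_{k\ge K_0+1}$ is nonincreasing, and there is $\bar\theta\ge0$ with $\lim_{k\to\infty}\theta_k=\bar\theta$; (ii) $\{W^k\}$ is bounded; (iii) $\Pi(\bar x,\bar z,\bar u)=\bar\theta$ for every $(\bar x,\bar y,\bar z,\bar u)\in\Omega$; (iv a) if $K_\varepsilon:=\{w\in\mathbb{R}^s:\operatorname{dist}(w,A(\mathcal{S}))\le\varepsilon\}\subseteq\operatorname{int}(\operatorname{dom}g)$, then $g$ is Lipschitz continuous on the compact set $K_\varepsilon$ with some constant $\kappa>0$, and every accumulation point of $\{x^k\}$ is a limiting $(2\kappa\varepsilon,(2\kappa+1)\varepsilon)$-lifted stationary point of the problem; (iv b) if $g$ has full domain and is differentiable with $L_{\nabla g}$-Lipschitz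 continuous gradient ($L_{\nabla g}>0$), then every accumulation point of $\{x^k\}$ is a limiting $\left(\frac{L_{\nabla g}\varepsilon^2}{2},\frac{L_{\nabla g}\varepsilon^2}{2}+\varepsilon\right)$-lifted stationary point of the problem; (v) $\lim_{k\to\infty}\frac{\langle Kx^{k+1},y^{k+1}\rangle-f^*(y^{k+1})}{f(Kx^k)}=1$; furthermore, for any constants $m,M>0$ with $m<\inf_{k\ge1}f(Kx^k)$ and $\sup_{k\ge1}f(Kx^k)\le M$, there exists an index $K_1\ge K_0+1$ such that $0<m\le\langle Kx^k,y^k\rangle-f^*(y^k)\le f(Kx^k)\le M$ for all $k\ge K_1$.
   Context: Setting: the problem is $\min_{x\in\mathcal{S}}\frac{g(Ax)+h(x)}{f(Kx)}$, where $\mathcal{S}\subseteq\mathbb{R}^n$ is nonempty, convex, compact; $A:\mathbb{R}^n\to\mathbb{R}^s$, $K:\mathbb{R}^n\to\mathbb{R}^p$ linear with adjoints $A^*,K^*$ and operator norm $\|A\|$; $g:\mathbb{R}^s\to\mathbb{R}\cup\{+\infty\}$ proper, convex, lsc; $h:\mathbb{R}^n\to\mathbb{R}$ differentiable on an open set containing $\mathcal{S}$ with $L_{\nabla h}$-Lipschitz gradient there; $f:\mathbb{R}^p\to\mathbb{R}\cup\{+\infty\}$ proper, convex, lsc with $K(\mathcal{S})\subseteq\operatorname{int}(\operatorname{dom}f)$ and $f(Kx)>0$ on $\mathcal{S}$; $\mathcal{S}\cap A^{-1}(\operatorname{dom}g)\ne\emptyset$, $\inf_{x\in\mathcal{S}}\{g(Ax)+h(x)\}>0$;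 $A(\mathcal{S})\subseteq\operatorname{dom}(\partial g)$ and there is $\ell>0$ with $\operatorname{dist}(0,\partial g(Ax))\le\ell$ for all $x\in\mathcal{S}$. Notation: $f^*,g^*$ Fenchel conjugates; $\iota_{\mathcal{S}}$ indicator; $\operatorname{Proj}_{\mathcal{S}}$ projection; $\operatorname{prox}_{\varphi,\kappa}(x)=\arg\min_y\{\varphi(y)+\frac1{2\kappa}\|y-x\|^2\}$; $\Psi(x,z,u,\delta,\gamma):=\langle z,Ax\rangle-g^*(z)+h(x)+\iota_{\mathcal{S}}(x)+\frac{\delta}{2}\|x-u\|^2-\frac{\gamma}{2}\|z\|^2$. For $\epsilon\ge0$, $\partial_\epsilon g(w):=\{v:g(w')\ge g(w)+\langle v,w'-w\rangle-\epsilon\ \forall w'\}$; $\partial$ is the convex subdifferential. Given $\epsilon_1,\epsilon_2\ge0$, $\bar x$ is a limiting $(\epsilon_1,\epsilon_2)$-lifted stationary point of the problem if there is $\bar\Psi\in\mathbb{R}$ with $|\bar\Psi-(g(A\bar x)+h(\bar x))|\le\epsilon_2$ and $0\in\big(A^*\partial_{\epsilon_1}g(A\bar x)+\nabla h(\bar x)+\partial\iota_{\mathcal{S}}(\bar x)\big)f(K\bar x)-\bar\Psi K^*\partial f(K\bar x)$. Algorithm: given $0<\beta<2$, $\nu>0$, $0<q<1$, $\delta_0,\theta_0>0$, $\gamma_0=1$, $\varepsilon>0$ and $(x^0,z^0,u^0)$, for $k\ge0$: choose $y^{k+1}\in\partial f(Kx^k)$; $x^{k+1}:=\operatorname{Proj}_{\mathcal{S}}(u^k+\frac{\theta_k}{\delta_k}K^*y^{k+1}-\frac1{\delta_k}\nabla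 h(x^k)-\frac1{\delta_k}A^*z^k)$; $u^{k+1}:=(1-\beta)u^k+\beta x^{k+1}$; take the smallest $j_k\ge0$ such that with $\gamma_{k,j_k}:=\gamma_kq^{j_k}$, $z^{k+1,j_k}:=\operatorname{prox}_{g^*,1/\gamma_{k,j_k}}(Ax^{k+1}/\gamma_{k,j_k})$ one has $\theta_{k+1}:=\Psi(x^{k+1},z^{k+1,j_k},u^{k+1},\delta_k,\gamma_{k,j_k})/f(Kx^{k+1})>0$; set $\gamma_{k+1}:=\gamma_{k,j_k}$, $\delta_{k+1}:=2\nu+L_{\nabla h}+2\|A\|^2/\gamma_{k+1}$, $z^{k+1}:=z^{k+1,j_k}$; if $\|z^{k+1}\|>\min(\varepsilon/\gamma_{k+1},\sqrt{2\varepsilon/\gamma_{k+1}})$, replace $\gamma_{k+1}$ by $\gamma_{k+1}q$ and recompute $\delta_{k+1}$ by the same formula. *)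

(* Defs.v *)
From mathcomp Require Import all_boot all_order all_algebra.
From mathcomp Require Import all_classical all_reals all_analysis.
Import Order.TTheory GRing.Theory Num.Theory.
Import numFieldNormedType.Exports.
Local Open Scope classical_set_scope.
Local Open Scope ring_scope.

Section Defs.
Context {R : realType}.

Definition inner {n : nat} (x y : 'cV[R]_n) : R := \sum_i x i 0 * y i 0.
Definition enorm {n : nat} (x : 'cV[R]_n) : R := Num.sqrt (inner x x).

Definition opnorm {m n : nat} (A : 'M[R]_(m, n)) : R :=
  sup [set enorm (A *m v) | v in [set v : 'cV[R]_n | enorm v <= 1]].

Definition dist_set {n : nat} (w : 'cV[R]_n) (E : set 'cV[R]_n) : R :=
  inf [set enorm (w - e) | e in E].

Definition convex_set_cv {n : nat} (S : set 'cV[R]_n) : Prop :=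
  forall (a b : 'cV[R]_n) (t : R), S a -> S b -> 0 <= t <= 1 -> S (t *: a + (1 - t) *: b).

Definition edom {n : nat} (phi : 'cV[R]_n -> \bar R) : set 'cV[R]_n :=
  [set v | (phi v < +oo)%E].

Definition proper_fun {n : nat} (phi : 'cV[R]_n -> \bar R) : Prop :=
  (exists v, (phi v < +oo)%E) /\ (forall v, (-oo < phi v)%E).

Definition convex_fun {n : nat} (phi : 'cV[R]_n -> \bar R) : Prop :=
  forall (a b : 'cV[R]_n) (t : R), 0 < t < 1 ->
    (phi (t *: a + (1 - t) *: b)%R <= t%:E * phi a + (1 - t)%:E * phi b)%E.

Definition lsc_fun {n : nat} (phi : 'cV[R]_n -> \bar R) : Prop :=
  forall v (r : R), (r%:E < phi v)%E -> \forall w \near v, (r%:E < phi w)%E.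

Definition fconj {n : nat} (phi : 'cV[R]_n -> \bar R) (w : 'cV[R]_n) : \bar R :=
  ereal_sup [set ((inner w v)%:E - phi v)%E | v in [set: 'cV[R]_n]].

Definition esubdiff {n : nat} (phi : 'cV[R]_n -> \bar R) (eps : R)
    (w : 'cV[R]_n) : set 'cV[R]_n :=
  [set v | forall w', (phi w + (inner v (w' - w) - eps)%:E <= phi w')%E].
Definition subdiff {n : nat} (phi : 'cV[R]_n -> \bar R) := esubdiff phi 0.

Definition indic {n : nat} (S : set 'cV[R]_n) (v : 'cV[R]_n) : \bar R :=
  if v \in S then 0%E else +oo%E.

Definition is_proj {n : nat} (S : set 'cV[R]_n) (v p : 'cV[R]_n) : Prop :=
  S p /\ forall w, S w -> enorm (p - v) <= enorm (w - v).

Definition is_prox {n : nat} (phi : 'cV[R]_n -> \bar R) (kappa : R)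
    (v p : 'cV[R]_n) : Prop :=
  forall w, (phi p + (enorm (p - v) ^+ 2 / (2 * kappa))%:E
             <= phi w + (enorm (w - v) ^+ 2 / (2 * kappa))%:E)%E.

Definition is_grad {n : nat} (h : 'cV[R]_n -> R) (v d : 'cV[R]_n) : Prop :=
  forall e : R, 0 < e -> exists r : R, 0 < r /\ forall w, enorm w < r ->
    `|h (v + w) - h v - inner d w| <= e * enorm w.

Definition Psi {n s : nat} (A : 'M[R]_(s, n)) (g : 'cV[R]_s -> \bar R)
    (h : 'cV[R]_n -> R) (S : set 'cV[R]_n)
    (x : 'cV[R]_n) (z : 'cV[R]_s) (u : 'cV[R]_n) (delta gamma : R) : \bar R :=
  ((inner z (A *m x))%:E - fconj g z + (h x)%:E + indic S x
   + (delta / 2 * enorm (x - u) ^+ 2 - gamma / 2 * enorm z ^+ 2)%:E)%E.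

(* a / b for an extended real a and a (finite) extended real b *)
Definition ediv (a b : \bar R) : \bar R := (a * ((fine b)^-1)%:E)%E.

Definition PsiQ {n s p : nat} (A : 'M[R]_(s, n)) (K : 'M[R]_(p, n))
    (g : 'cV[R]_s -> \bar R) (h : 'cV[R]_n -> R) (f : 'cV[R]_p -> \bar R)
    (S : set 'cV[R]_n)
    (x : 'cV[R]_n) (z : 'cV[R]_s) (u : 'cV[R]_n) (delta gamma : R) : \bar R :=
  ediv (Psi A g h S x z u delta gamma) (f (K *m x)).

Definition lifted_stationary {n s p : nat} (A : 'M[R]_(s, n)) (K : 'M[R]_(p, n))
    (g : 'cV[R]_s -> \bar R) (h : 'cV[R]_n -> R) (gradh : 'cV[R]_n -> 'cV[R]_n)
    (f : 'cV[R]_p -> \bar R) (S : set 'cV[R]_n) (eps1 eps2 : R)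
    (xb : 'cV[R]_n) : Prop :=
  exists Pb : R,
    ((Pb - eps2)%:E <= g (A *m xb) + (h xb)%:E <= (Pb + eps2)%:E)%E /\
    exists (v : 'cV[R]_s) (w : 'cV[R]_n) (xi : 'cV[R]_p),
      esubdiff g eps1 (A *m xb) v /\ subdiff (indic S) xb w /\
      subdiff f (K *m xb) xi /\
      fine (f (K *m xb)) *: (A^T *m v + gradh xb + w) - Pb *: (K^T *m xi) = 0.

End Defs.

(* Main.v *)
Require Import Defs.
From mathcomp Require Import all_boot all_order all_algebra.
From mathcomp Require Import all_classical all_reals all_analysis.
From mathcomp Require Import ring lra.
Import Order.TTheory GRing.Theory Num.Theory.
Import numFieldNormedType.Exports.
Local Open Scope classical_set_scope.
Local Open Scope ring_scope.

(* Since prox of g^* at Ax/gamma is z with z in the subdifferential of g at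
   Ax - gamma z, the dual step evaluates the Moreau envelope of g at Ax, and
   Psi(x^k, z^k, u^k) = env(Ax^k) + h(x^k) + delta/2 |x^k - u^k|^2 with a smooth
   envelope. Existence of the primal prox replaces the identity g^** = g.
   The descent lemma for env o A + h, the variational inequality of the projection
   and the subgradient inequality of f give
     theta_{k+1} f(Kx^{k+1}) <= theta_k f(Kx^{k+1}) - nu |x^{k+1} - x^k|^2
                                 - delta/2 beta(2 - beta) |x^{k+1} - u^k|^2,
   so theta_k converges, all increments vanish, and along x^k -> xb the optimality
   condition of the projection passes to the limit. The limit dual point
   z = z(Axb) is a subgradient of g at Axb - gamma z, which lies within eps of Axb;
   regularity of g turns it into an approximate subgradient at Axb. *)

(** The terms of [delta] are a budget for one step: the Lipschitz gradient of [h] costs [Lh / 2]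
    times |x^{k+1} - x^k|^2, the envelope composed with [A] costs |A|^2 / (2 gamma) times the same
    square, and delta/2 covers both and leaves at least [nu]. The factor beta(2 - beta) is 1 - (1 -
    beta)^2, because x^{k+1} - u^{k+1} = (1 - beta)(x^{k+1} - u^k). The algorithm computes a prox of
    the conjugate, while the argument takes place on [g]. The bridge is a map [zp] choosing [zp a]
    as a subgradient of [g] at [a - gam *: zp a]: equality in Fenchel's inequality forces every dual
    prox to coincide with [zp a], and one subgradient inequality between two such points yields both
    the smoothness of the envelope and the Lipschitz continuity of [zp], without ever
    differentiating the envelope. Both [g] and [f] may be infinite. For [f] the remedy is that K(S)
    is compact inside the interior of the domain: this bounds the subgradients y^{k+1}, so that they
    have limits, and makes f(Kx) continuous on [S]. *)

Set Implicit Arguments.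
Unset Strict Implicit.

(** * Euclidean inner product, norm and operator norm *)

Section Euclidean.
Context {R : realType}.
Implicit Types n m : nat.

Lemma innerC n (x y : 'cV[R]_n) : inner x y = inner y x.
Proof. by apply: eq_bigr => i _; rewrite mulrC. Qed.

Lemma innerDl n (x y z : 'cV[R]_n) : inner (x + y) z = inner x z + inner y z.
Proof. by rewrite /inner -big_split; apply: eq_bigr => i _; rewrite mxE mulrDl. Qed.

Lemma innerZl n a (x y : 'cV[R]_n) : inner (a *: x) y = a * inner x y.
Proof. by rewrite /inner mulr_sumr; apply: eq_bigr => i _; rewrite mxE mulrA. Qed.

Lemma innerNl n (x y : 'cV[R]_n) : inner (- x) y = - inner x y.
Proof. by rewrite -scaleN1r innerZl mulN1r. Qed.

Lemma innerBl n (x y z : 'cV[R]_n) : inner (x - y) z = inner x z - inner y z.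
Proof. by rewrite innerDl innerNl. Qed.

Lemma innerDr n (x y z : 'cV[R]_n) : inner z (x + y) = inner z x + inner z y.
Proof. by rewrite innerC innerDl !(innerC z). Qed.

Lemma innerZr n a (x y : 'cV[R]_n) : inner y (a *: x) = a * inner y x.
Proof. by rewrite innerC innerZl innerC. Qed.

Lemma innerNr n (x y : 'cV[R]_n) : inner y (- x) = - inner y x.
Proof. by rewrite innerC innerNl innerC. Qed.

Lemma innerBr n (x y z : 'cV[R]_n) : inner z (x - y) = inner z x - inner z y.
Proof. by rewrite innerDr innerNr. Qed.

Lemma inner0l n (x : 'cV[R]_n) : inner 0 x = 0.
Proof. by rewrite -(scale0r x) innerZl mul0r. Qed.

Lemma inner0r n (x : 'cV[R]_n) : inner x 0 = 0.
Proof. by rewrite innerC inner0l. Qed.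

Definition innerE := (@innerDl, @innerDr, @innerNl, @innerNr, @innerZl, @innerZr,
  @inner0l, @inner0r).

Lemma inner_mul n m (M : 'M[R]_(m, n)) (x : 'cV[R]_n) (y : 'cV[R]_m) :
  inner (M *m x) y = inner x (M^T *m y).
Proof.
rewrite /inner; under eq_bigr do rewrite mxE mulr_suml.
rewrite exchange_big; apply: eq_bigr => j _; rewrite mxE mulr_sumr.
by apply: eq_bigr => i _; rewrite mxE mulrAC mulrC.
Qed.

Lemma inner_ge0 n (x : 'cV[R]_n) : 0 <= inner x x.
Proof. by apply: sumr_ge0 => i _; rewrite -expr2 sqr_ge0. Qed.

Lemma enorm_ge0 n (x : 'cV[R]_n) : 0 <= enorm x.
Proof. exact: sqrtr_ge0. Qed.

Lemma enorm_sqr n (x : 'cV[R]_n) : enorm x ^+ 2 = inner x x.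
Proof. by rewrite sqr_sqrtr // inner_ge0. Qed.

Lemma enorm_leP n (x : 'cV[R]_n) (r : R) : 0 <= r ->
  (enorm x <= r) = (inner x x <= r ^+ 2).
Proof. by move=> r0; rewrite -enorm_sqr ler_pXn2r // nnegrE enorm_ge0. Qed.

Lemma enorm0 n : enorm (0 : 'cV[R]_n) = 0.
Proof. by rewrite /enorm inner0l sqrtr0. Qed.

Lemma enormZ n a (x : 'cV[R]_n) : enorm (a *: x) = `|a| * enorm x.
Proof. by rewrite /enorm innerZl innerZr mulrA -expr2 sqrtrM ?sqr_ge0// sqrtr_sqr. Qed.

Lemma enormN n (x : 'cV[R]_n) : enorm (- x) = enorm x.
Proof. by rewrite -scaleN1r enormZ normrN1 mul1r. Qed.

Lemma enormB n (x y : 'cV[R]_n) : enorm (x - y) = enorm (y - x).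
Proof. by rewrite -opprB enormN. Qed.

Lemma coord_le_enorm n (x : 'cV[R]_n) i : `|x i 0| <= enorm x.
Proof.
rewrite -sqrtr_sqr ler_sqrt ?inner_ge0// /inner (bigD1 i)//= -expr2 lerDl.
by apply: sumr_ge0 => j _; rewrite -expr2 sqr_ge0.
Qed.

(** The crude factor [n] is enough: with [coord_le_enorm] it makes the Euclidean and the entrywise
    norm equivalent. *)
Lemma enorm_le_coord n (x : 'cV[R]_n) (r : R) :
  (forall i, `|x i 0| <= r) -> enorm x <= n%:R * r.
Proof.
move=> xr; case: n x xr => [|n] x xr.
  by rewrite mul0r /enorm /inner big_ord0 sqrtr0.
have r0 : 0 <= r by apply: le_trans (xr 0).
rewrite enorm_leP ?mulr_ge0//.
apply: (@le_trans _ _ (\sum_(i < n.+1) r ^+ 2)).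
  apply: ler_sum => i _; rewrite -expr2 -real_normK ?num_real//.
  by rewrite ler_pXn2r// nnegrE.
rewrite sumr_const card_ord -[leLHS]mulr_natl exprMn ler_wpM2r ?sqr_ge0//.
by rewrite expr2 -natrM ler_nat leq_pmulr.
Qed.

Lemma enorm_eq0 n (x : 'cV[R]_n) : enorm x = 0 -> x = 0.
Proof.
move=> x0; apply/colP => i; rewrite mxE; apply/eqP.
by rewrite -normr_le0 -x0 coord_le_enorm.
Qed.

Lemma inner_self_eq0 n (x : 'cV[R]_n) : inner x x <= 0 -> x = 0.
Proof.
move=> x0; apply/enorm_eq0/eqP.
by rewrite eq_le enorm_ge0 andbT enorm_leP// expr0n.
Qed.

Lemma inner_le_enorm n (x y : 'cV[R]_n) : inner x y <= enorm x * enorm y.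
Proof.
have [x0|x0] := eqVneq (enorm x) 0.
  by rewrite (enorm_eq0 x0) inner0l enorm0 mul0r.
have [y0|y0] := eqVneq (enorm y) 0.
  by rewrite (enorm_eq0 y0) inner0r enorm0 mulr0.
have xp : 0 < enorm x by rewrite lt_neqAle eq_sym x0 enorm_ge0.
have yp : 0 < enorm y by rewrite lt_neqAle eq_sym y0 enorm_ge0.
(* Cauchy-Schwarz from a single square: it expands to [2 * a * b * (a * b - c)], and [a * b] is
   positive. *)
have := inner_ge0 (enorm y *: x - enorm x *: y).
rewrite !innerE -!enorm_sqr (innerC y x).
set a := enorm x; set b := enorm y; set c := inner x y => H.
have ab0 : 0 < a * b by rewrite mulr_gt0.
rewrite -(ler_pM2l ab0); nra.
Qed.

Lemma abs_inner_le n (x y : 'cV[R]_n) : `|inner x y| <= enorm x * enorm y.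
Proof.
by rewrite ler_norml inner_le_enorm andbT lerNl -innerNl -(enormN x) inner_le_enorm.
Qed.

Lemma enormD n (x y : 'cV[R]_n) : enorm (x + y) <= enorm x + enorm y.
Proof.
rewrite enorm_leP ?addr_ge0 ?enorm_ge0// !innerE (innerC y x) -!enorm_sqr.
have := inner_le_enorm x y; nra.
Qed.

Lemma inner_young n (c : R) (x y : 'cV[R]_n) : 0 < c ->
  inner x y <= c / 2 * inner x x + inner y y / (2 * c).
Proof.
move=> c0; have := inner_ge0 (c *: x - y).
rewrite !innerE (innerC y x) => H.
rewrite -subr_ge0.
have -> : c / 2 * inner x x + inner y y / (2 * c) - inner x y
    = (c * (c * inner x x) + inner y y - 2 * c * inner x y) / (2 * c).
  by field; rewrite gt_eqF.
by apply: divr_ge0; [move: H; lra | rewrite mulr_ge0// ltW].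
Qed.

Lemma opnorm_ub n m (M : 'M[R]_(m, n)) (v : 'cV[R]_n) :
  enorm (M *m v) <= opnorm M * enorm v.
Proof.
have [v0|v0] := eqVneq (enorm v) 0.
  by rewrite (enorm_eq0 v0) mulmx0 !enorm0 mulr0.
have vp : 0 < enorm v by rewrite lt_neqAle eq_sym v0 enorm_ge0.
rewrite -ler_pdivrMr// mulrC.
have -> : (enorm v)^-1 * enorm (M *m v) = enorm (M *m ((enorm v)^-1 *: v)).
  by rewrite -scalemxAr enormZ ger0_norm// invr_ge0 enorm_ge0.
apply: ub_le_sup; last first.
  exists ((enorm v)^-1 *: v) => //=.
  by rewrite enormZ ger0_norm ?invr_ge0 ?enorm_ge0// mulVf.
(* [sup] dominates its set only if the set is bounded above, so some bound, however crude, must be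
   supplied. *)
pose C := \sum_i \sum_j `|M i j|.
exists (m%:R * C) => _ [w /= w1 <-]; apply: enorm_le_coord => i.
rewrite mxE; apply: (le_trans (ler_norm_sum _ _ _)).
apply: (@le_trans _ _ (\sum_j `|M i j|)).
  apply: ler_sum => j _; rewrite normrM ler_piMr//.
  exact: (le_trans (coord_le_enorm w j) w1).
rewrite /C (bigD1 i)//= lerDl; apply: sumr_ge0 => k _.
by apply: sumr_ge0.
Qed.

End Euclidean.

(** * Convergence, compactness and subsequences in the Euclidean norm *)

Section Convergence.
Context {R : realType}.

Lemma nbhs_enormP n (a : 'cV[R]_n) (U : set 'cV[R]_n) :
  nbhs a U <-> exists2 r : R, 0 < r & forall w, enorm (w - a) < r -> U w.
Proof.
split=> [/nbhs_ballP[r /= r0 aU]|[r r0 aU]].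
  exists r => // w wa; apply: aU; split=> // i j.
  rewrite (ord1 j) /ball /= distrC.
  by apply: le_lt_trans wa; have := coord_le_enorm (w - a) i; rewrite !mxE.
(* Dividing by [n.+1] rather than [n] covers dimension 0 and keeps the final inequality strict. *)
apply/nbhs_ballP; exists (r / n.+1%:R) => /= [|w [_ aw]].
  by rewrite divr_gt0.
apply: aU; apply: (@le_lt_trans _ _ (n%:R * (r / n.+1%:R))).
  apply: enorm_le_coord => i; rewrite !mxE distrC ltW//.
  exact: (aw i 0).
by rewrite mulrCA -subr_gt0 -[X in X - _]mulr1 -mulrBr mulr_gt0// subr_gt0
  ltr_pdivrMr// mul1r ltr_nat.
Qed.

Section filtered.
Context {I : Type} {F : set_system I} {FF : Filter F}.

Lemma cvg_inner n (u v : I -> 'cV[R]_n) (a b : 'cV[R]_n) :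
  u @ F --> a -> v @ F --> b -> inner (u k) (v k) @[k --> F] --> inner a b.
Proof.
move=> ua vb; rewrite /inner; apply: cvg_big => [|i _]; first exact: add_continuous.
have cvgc (w : I -> 'cV[R]_n) (c : 'cV[R]_n) : w @ F --> c -> w k i 0 @[k --> F] --> c i 0.
  by move=> wc; exact: (cvg_comp w (fun M => M i 0) wc (@coord_continuous R n 1 i 0 c)).
by apply: cvgM; exact: cvgc.
Qed.

Lemma cvg_enorm n (u : I -> 'cV[R]_n) (a : 'cV[R]_n) :
  u @ F --> a -> enorm (u k) @[k --> F] --> enorm a.
Proof.
move=> ua; have H := cvg_inner ua ua.
by apply: (cvg_comp _ _ H); exact: sqrt_continuous.
Qed.

Lemma cvg_enormB0 n (u : I -> 'cV[R]_n) (a : 'cV[R]_n) :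
  u @ F --> a -> enorm (u k - a) @[k --> F] --> 0.
Proof.
move=> ua; rewrite -(@enorm0 R n) -(subrr a); apply: cvg_enorm.
by apply: cvgB => //; exact: cvg_cst.
Qed.

Lemma enormB0_cvg n (u : I -> 'cV[R]_n) (a : 'cV[R]_n) :
  enorm (u k - a) @[k --> F] --> 0 -> u @ F --> a.
Proof.
move=> ua U /nbhs_enormP[r r0 aU].
have /cvgrPdist_lt/(_ r r0) H := ua.
by apply: filterS H => k; rewrite sub0r normrN ger0_norm ?enorm_ge0// => /aU.
Qed.

Lemma cvg0_le (u v : I -> R) : (\forall k \near F, `|u k| <= v k) ->
  v @ F --> 0 -> u @ F --> 0.
Proof.
move=> uv v0; apply: (@squeeze_cvgr _ _ _ _ (fun k => - v k) v) => //.
  by apply: filterS uv => k; rewrite ler_norml.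
by rewrite -oppr0; exact: cvgN.
Qed.

Lemma cvg_near_eq (T : topologicalType) (u v : I -> T) (l : T) :
  u @ F --> l -> (\forall k \near F, v k = u k) -> v @ F --> l.
Proof. by move=> ul uv; exact: cvg_trans (near_eq_cvg (filterS (fun k => esym) uv)) ul. Qed.

Lemma cvg_mulcl (c : R) (u : I -> R) (l : R) :
  u @ F --> l -> c * u k @[k --> F] --> c * l.
Proof. by move=> ul; apply: cvgM => //; exact: cvg_cst. Qed.

Lemma cvg_mulmx n m (M : 'M[R]_(m, n)) (u : I -> 'cV[R]_n) (a : 'cV[R]_n) :
  u @ F --> a -> M *m u k @[k --> F] --> M *m a.
Proof.
move=> /cvg_enormB0 ua; apply: enormB0_cvg.
apply: (@cvg0_le _ (fun k => opnorm M * enorm (u k - a))).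
  by near=> k; rewrite ger0_norm ?enorm_ge0// -mulmxBr opnorm_ub.
by rewrite -(mulr0 (opnorm M)); apply: cvgM => //; exact: cvg_cst.
Unshelve. all: by end_near. Qed.

End filtered.

(** Heine-Borel. [rV_compact] treats boxes of row vectors, so the box is transported by
    transposition. *)
Lemma bounded_closed_cV_compact n (E : set 'cV[R]_n) (B : R) :
  closed E -> (forall w, E w -> enorm w <= B) -> compact E.
Proof.
move=> Ec EB.
pose box := [set v : 'rV[R]_n | forall i, `[(- B), B]%classic (v ord0 i)].
have boxc : compact box.
  by apply: (@rV_compact R n (fun=> `[(- B), B]%classic)) => i; exact: segment_compact.
have cb : compact ((@trmx R 1 n) @` box).
  apply: continuous_compact => //; apply: (@continuous_subspaceT _ _ box (@trmx R 1 n)) => v.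
  move=> U /nbhs_ballP[r /= r0 aU]; apply/nbhs_ballP; exists r => //= w [_ vw].
  by apply: aU; split=> // i j; rewrite !mxE; exact: vw.
apply: (subclosed_compact Ec cb) => w Ew; exists w^T; last by rewrite trmxK.
move=> i /=; rewrite mxE in_itv /= -ler_norml.
exact: le_trans (coord_le_enorm _ _) (EB _ Ew).
Qed.

Lemma compact_ball n (c : 'cV[R]_n) (r : R) :
  compact [set w : 'cV[R]_n | enorm (w - c) <= r].
Proof.
apply: (@bounded_closed_cV_compact _ _ (enorm c + r)) => [|w /= wr].
  apply: (@closed_comp _ _ (fun w : 'cV[R]_n => enorm (w - c)) [set t | t <= r]).
    move=> w _; apply: (@cvg_enorm _ (nbhs w) _ _ (fun w => w - c)).
    by apply: cvgB; [exact: cvg_id | exact: cvg_cst].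
  exact: closed_le.
rewrite -[w](subrKC c); apply: (le_trans (enormD _ _)).
by rewrite lerD2l.
Qed.

Lemma compact_enorm_bounded n (E : set 'cV[R]_n) :
  compact E -> exists B : R, forall e, E e -> enorm e <= B.
Proof.
move=> cE.
have Nc : compact ((fun v => enorm v) @` E).
  apply: continuous_compact => //; apply: continuous_subspaceT => v.
  by apply: (@cvg_enorm _ (nbhs v)); exact: cvg_id.
have [M [_ HM]] := compact_bounded Nc.
exists (M + 1) => e Ee; have := HM (M + 1); rewrite ltrDl => /(_ ltr01 (enorm e)).
by rewrite /= ger0_norm ?enorm_ge0//; apply; exists e.
Qed.

(** Subsequences are encoded by [k <= phi k] alone: this already carries limits over, and it is
    stable under composition. *)
Lemma cvg_subseq (T : topologicalType) (u : nat -> T) (l : T) (phi : nat -> nat) :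
  (forall k, (k <= phi k)%N) -> u @ \oo --> l -> (u \o phi) @ \oo --> l.
Proof.
move=> phik ul; apply: (cvg_comp _ _ _ ul) => U [N _ NU].
by exists N => // k /= Nk; apply: NU => /=; exact: leq_trans Nk (phik k).
Qed.

Lemma cvg_pair_components (T1 T2 : topologicalType) (w : nat -> T1 * T2)
    (l1 : T1) (l2 : T2) :
  w @ \oo --> (l1, l2) -> (fun k => (w k).1) @ \oo --> l1 /\ (fun k => (w k).2) @ \oo --> l2.
Proof.
move=> wl; split=> U lU.
  apply: (wl [set t | U t.1]); exists (U, setT); last by move=> t [].
  by split=> //; exact: filterT.
apply: (wl [set t | U t.2]); exists (setT, U); last by move=> t [].
by split=> //; exact: filterT.
Qed.

(** For each [k] an index at least [k] is chosen with its term within [1 / (k + 1)] of [l]. The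
    general [T] lets this apply to the quadruples (x, y, z, u) as well. *)
Lemma cluster_subseq (T : pseudoMetricType R) (u : nat -> T) (l : T) :
  cluster (u @ \oo) l ->
  exists2 phi : nat -> nat, forall k, (k <= phi k)%N & (u \o phi) @ \oo --> l.
Proof.
move=> ul.
have H k : exists j, (k <= j)%N /\ ball l k.+1%:R^-1 (u j).
  have [] := ul (u @` [set j | (k <= j)%N]) (ball l k.+1%:R^-1).
  - by exists k => // j /= kj; exists j.
  - by apply: nbhsx_ballx; rewrite invr_gt0.
  - by move=> _ [[j /= kj <-] lj]; exists j.
have [phi phiP] := choice H.
exists phi => [k|]; first by have [] := phiP k.
apply/cvg_ballP => e e0; near=> k.
apply: (@le_ball _ _ _ k.+1%:R^-1); last by have [] := phiP k.
by apply/ltW; near: k; exact: (near_infty_natSinv_lt (PosNum e0)).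
Unshelve. all: by end_near. Qed.

Lemma compact_subseq (T : pseudoMetricType R) (E : set T) (u : nat -> T) :
  compact E -> (forall k, E (u k)) ->
  exists (l : T) (phi : nat -> nat),
    [/\ E l, forall k, (k <= phi k)%N & (u \o phi) @ \oo --> l].
Proof.
move=> Ec Eu; have [|l [El /cluster_subseq[phi phik phil]]] := Ec (u @ \oo) _.
  by exists 0%N => // k _; exact: Eu.
by exists l, phi.
Qed.

End Convergence.

(** * Gradients and the descent lemma *)

Section Smooth.
Context {R : realType}.

Lemma grad_cvg n (I : Type) (F : set_system I) (FF : Filter F)
    (h : 'cV[R]_n -> R) (v d : 'cV[R]_n) (u : I -> 'cV[R]_n) :
  is_grad h v d -> u @ F --> v -> h (u k) @[k --> F] --> h v.
Proof.
move=> /(_ 1 ltr01)[r [r0 hr]] /cvg_enormB0 uv; apply/cvgrPdist_le => e e0.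
have c0 : 0 < 1 + enorm d by rewrite ltr_pwDl// enorm_ge0.
have /cvgrPdist_lt/(_ (Num.min r (e / (1 + enorm d)))) := uv.
rewrite lt_min r0 divr_gt0// => /(_ isT); apply: filterS => k.
rewrite sub0r normrN ger0_norm ?enorm_ge0// lt_min => /andP[kr ke].
have := hr _ kr; rewrite mul1r subrKC distrC => hk.
have dk := abs_inner_le d (u k - v).
rewrite ltr_pdivlMr// in ke.
have := ler_normD (h (u k) - h v - inner d (u k - v)) (inner d (u k - v)).
rewrite subrK distrC => T; apply: (le_trans T).
rewrite distrC in hk; lra.
Qed.

Lemma grad_is_derive n (h : 'cV[R]_n -> R) (a d g : 'cV[R]_n) (t : R) :
  is_grad h (a + t *: d) g ->
  is_derive t 1 (fun s : R => h (a + s *: d)) (inner g d).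
Proof.
move=> hg.
suff H : (fun s : R => s^-1 *: ((h (a + (s *: 1 + t) *: d) : R^o) - h (a + t *: d)))
    @ 0^' --> (inner g d : R^o).
  split; first by apply/cvg_ex; exists (inner g d).
  exact: cvg_lim H.
(* The added 1 keeps the divisor positive when [d] is 0. *)
have c0 : 0 < 1 + enorm d by rewrite ltr_pwDl// enorm_ge0.
apply/cvgrPdist_le => e e0.
have [r [r0 hr]] := hg (e / (1 + enorm d)) (divr_gt0 e0 c0).
near=> s.
have s0 : s != 0 by near: s; exact: nbhs_dnbhs_neq.
have sr : `|s| < r / (1 + enorm d).
  near: s; apply: dnbhs0_lt; exact: divr_gt0.
have sd : enorm (s *: d) < r.
  rewrite enormZ; rewrite ltr_pdivlMr// in sr; apply: le_lt_trans sr.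
  by rewrite ler_wpM2l// lerDr.
have := hr _ sd.
have -> : a + t *: d + s *: d = a + (s *: (1:R) + t) *: d.
  by rewrite [s *: (1:R)]mulr1 scalerDl -addrA [t *: d + _]addrC.
rewrite innerZr enormZ => H.
have -> : inner g d - s^-1 *: ((h (a + (s *: (1:R) + t) *: d) : R^o) - h (a + t *: d))
  = - s^-1 * (h (a + (s *: (1:R) + t) *: d) - h (a + t *: d) - s * inner g d).
  have fE (G X : R) : G - s^-1 * X = - s^-1 * (X - s * G) by field.
  exact: fE.
rewrite normrM normrN normfV ler_pdivrMl ?normr_gt0//.
apply: (le_trans H); rewrite mulrCA ler_wpM2l// mulrAC.
rewrite ler_pdivrMr// ler_pM2l//; lra.
Unshelve. all: by end_near. Qed.

(** Mean value theorem for [phi], which is [h] on the segment minus its linearisation at [a] and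
    minus the quadratic bound: the Lipschitz estimate makes its derivative nonpositive, so
    [phi 1 <= phi 0]. *)
Lemma descent n (h : 'cV[R]_n -> R) (gradh : 'cV[R]_n -> 'cV[R]_n) (L : R)
    (D : set 'cV[R]_n) (a b : 'cV[R]_n) :
  (forall t, 0 <= t <= 1 -> D (a + t *: (b - a))) ->
  (forall v, D v -> is_grad h v (gradh v)) ->
  (forall v w, D v -> D w -> enorm (gradh v - gradh w) <= L * enorm (v - w)) ->
  h b <= h a + inner (gradh a) (b - a) + L / 2 * inner (b - a) (b - a).
Proof.
set d := b - a => Dd hg hL.
pose dphi t := inner (gradh (a + t *: d)) d - inner (gradh a) d - L * t * inner d d.
pose phi : R -> R := (fun s => h (a + s *: d)) - (fun s => s * inner (gradh a) d)
  - (fun s => L / 2 * inner d d * s ^+ 2).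
have dP (t : R) : t \in `[(0:R), 1] -> is_derive t 1 phi (dphi t).
  rewrite in_itv /= => /Dd/hg/grad_is_derive H.
  apply: is_derive_eq.
  rewrite /dphi; move: (inner (gradh _) d) (inner (gradh a) d) (inner d d) => X Y Z.
  have fE : X - (t * 0 + Y * 1) - L / 2 * Z * (t * 1 + t * 1) = X - Y - L * t * Z.
    by field.
  exact: fE.
have phic : {within `[(0:R), 1], continuous phi}.
  by apply: derivable_within_continuous => t /dP[].
have dP' (t : R) : t \in `](0:R), 1[ -> is_derive t 1 phi (dphi t).
  by move=> /subset_itv_oo_cc; exact: dP.
have le01 : (0:R) <= 1 by exact: ler01.
have [c c01] := MVT_segment le01 dP' phic.
rewrite subr0 mulr1 => E.
have c0 : 0 <= c <= 1 by move: c01; rewrite in_itv.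
have a0 : D a by have := Dd 0; rewrite scale0r addr0; apply; rewrite lexx ler01.
have P1 : phi 1 = h b - inner (gradh a) d - L / 2 * inner d d.
  rewrite /phi !fctE scale1r mul1r expr1n mulr1.
  by rewrite /d subrKC.
have P0 : phi 0 = h a by rewrite /phi !fctE scale0r addr0 mul0r expr0n mulr0 !subr0.
suff : dphi c <= 0 by move: E; rewrite P1 P0; lra.
rewrite /dphi -innerBl subr_le0; apply: (le_trans (inner_le_enorm _ _)).
have [c1 _] := andP c0.
rewrite -enorm_sqr expr2 mulrA ler_wpM2r ?enorm_ge0//.
apply: (le_trans (hL _ _ (Dd _ c0) a0)).
by rewrite addrAC subrr add0r enormZ ger0_norm// mulrA.
Qed.

End Smooth.

(** * Projections, subgradients and lower semicontinuity *)

Section Convex.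
Context {R : realType}.

Lemma ge0_small (c X : R) : (forall t, 0 < t < 1 -> - (t * c) <= X) -> 0 <= X.
Proof.
move=> H; rewrite leNgt; apply/negP => X0.
have c0 : 0 < `|c| + 1 by rewrite ltr_wpDl.
have D0 : 0 < 2 * (`|c| + 1 - X) by lra.
(* For negative [X] this [t] satisfies [t * |c| < - X / 2], which contradicts the assumption at
   [t]. *)
have tp : 0 < - X / (2 * (`|c| + 1 - X)) by rewrite divr_gt0// oppr_gt0.
have t1 : - X / (2 * (`|c| + 1 - X)) < 1 by rewrite ltr_pdivrMr//; lra.
have := H _ (introT andP (conj tp t1)).
set t := - X / _ in tp t1 *.
have E : t * (2 * (`|c| + 1 - X)) = - X by rewrite mulfVK// gt_eqF.
have := ler_norm c; nra.
Qed.

(** [p] is compared with [p + t (v - p)]; after division by [t] the remaining error is of order [t]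
    and is removed by [ge0_small]. *)
Lemma proj_variational n (E : set 'cV[R]_n) (c p : 'cV[R]_n) :
  convex_set_cv E -> is_proj E c p ->
  forall v, E v -> inner (c - p) (v - p) <= 0.
Proof.
move=> cE [Ep pmin] v Ev.
rewrite -oppr_ge0; apply: (@ge0_small (inner (v - p) (v - p) / 2)) => t /andP[t0 t1].
have t01 : 0 <= t <= 1 by rewrite !ltW.
have := pmin _ (cE v p t Ev Ep t01).
have -> : t *: v + (1 - t) *: p - c = (p - c) + t *: (v - p).
  by apply/colP => i; rewrite !mxE; ring.
rewrite enorm_leP ?enorm_ge0// enorm_sqr.
rewrite -(opprB p c); move: (p - c) (v - p) => d e.
rewrite !innerE (innerC e d) => H.
suff : 0 <= t * (2 * inner d e + t * inner e e).
  by rewrite pmulr_rge0//; lra.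
lra.
Qed.

(** If [phi w] were [+oo], the subgradient inequality would make [phi] infinite even at the point
    where properness provides a finite value. *)
Lemma subdiff_dom n (phi : 'cV[R]_n -> \bar R) (w v : 'cV[R]_n) :
  proper_fun phi -> subdiff phi w v -> exists r : R, phi w = r%:E.
Proof.
move=> [[w0 w0oo] /(_ w)] + /(_ w0); case: (phi w) => [r||]//; first by exists r.
by rewrite addye// leye_eq => _ /eqP E; rewrite E ltxx in w0oo.
Qed.

Lemma subdiff_ler n (phi : 'cV[R]_n -> \bar R) (w v w' : 'cV[R]_n) (r r' : R) :
  subdiff phi w v -> phi w = r%:E -> phi w' = r'%:E -> r + inner v (w' - w) <= r'.
Proof. by move=> /(_ w') + rE rE'; rewrite rE rE' lee_fin subr0. Qed.

(** Compactness makes a pointwise strict bound uniform. It stands in for the theorem of Weierstrass,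
    both for the existence of prox points and for the lower bound on f(Kx). *)
Lemma lsc_compact_gap n (phi : 'cV[R]_n -> \bar R) (C : set 'cV[R]_n) (m : R) :
  lsc_fun phi -> compact C -> (forall w, C w -> (m%:E < phi w)%E) ->
  exists2 e : R, 0 < e & forall w, C w -> ((m + e)%:E < phi w)%E.
Proof.
move=> lphi /compact_near_coveringP cC mphi.
have := cC R 0^'+ (fun e w => (m + e)%:E < phi w)%E _.
move=> /(_ _)[w Cw|d /= d0 H].
- have [r [mr rphi]] : exists r : R, m < r /\ (r%:E < phi w)%E.
    have := mphi _ Cw; case: (phi w) => [s|_|//].
      rewrite lte_fin => ms; exists ((m + s) / 2); rewrite lte_fin; split; lra.
    by exists (m + 1); rewrite ltey; split => //; lra.
  exists ([set w' | (r%:E < phi w')%E], [set e | m + e <= r]) => /=.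
    split; first exact: lphi.
    near=> e; have : e <= r - m by near: e; apply: nbhs_right_le; rewrite subr_gt0.
    by rewrite /=; lra.
  move=> [w' e] [/= rw' er]; apply: le_lt_trans rw'.
  by rewrite lee_fin.
- exists (d / 2) => [|w Cw]; first by rewrite divr_gt0.
  apply: (H (d / 2)) => //=; last by rewrite divr_gt0.
  rewrite sub0r normrN gtr0_norm ?divr_gt0//; lra.
Unshelve. all: by end_near. Qed.

End Convex.

(** * Existence of prox points; uniqueness of the dual prox *)

Section Moreau.
Context {R : realType} {n : nat}.
Implicit Types (phi : 'cV[R]_n -> \bar R) (a w z : 'cV[R]_n) (gam : R).

Lemma lsc_addr phi (c : 'cV[R]_n -> R) :
  lsc_fun phi -> continuous c -> lsc_fun (fun w => phi w + (c w)%:E)%E.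
Proof.
move=> lphi cc v r rv.
have [s [rs sv]] : exists s : R, r - c v < s /\ (s%:E < phi v)%E.
  move: rv; case: (phi v) => [t||]//.
    rewrite -EFinD lte_fin => rt; exists ((r - c v + t) / 2).
    by rewrite lte_fin; split; lra.
  by exists (r - c v + 1); rewrite ltey; split => //; lra.
have e0 : 0 < s - (r - c v) by rewrite subr_gt0.
have /cvgrPdist_lt/(_ _ e0) cn := cc v.
near=> w.
have h1 : (s%:E < phi w)%E by near: w; exact: (lphi v s sv).
have h2 : `|c v - c w| < s - (r - c v) by near: w; exact: cn.
case: (phi w) h1 => [t||]//; last by rewrite addye ?ltey.
rewrite -EFinD !lte_fin => st.
move: h2; rewrite ltr_norml => /andP[]; lra.
Unshelve. all: by end_near. Qed.

Lemma prox_exists phi (v0 : 'cV[R]_n) (c gam : R) a :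
  proper_fun phi -> lsc_fun phi -> (forall w, ((inner v0 w + c)%:E <= phi w)%E) ->
  0 < gam -> exists w, is_prox phi gam a w.
Proof.
move=> [[w0 w0oo] phiNoo] lphi minor g0.
pose q w := enorm (w - a) ^+ 2 / (2 * gam).
pose Phi w : \bar R := (phi w + (q w)%:E)%E.
have qc : continuous q.
  move=> w.
  have H : enorm (v - a) @[v --> w] --> enorm (w - a).
    apply: (@cvg_enorm _ _ (nbhs w) _ _ (fun v => v - a)).
    by apply: cvgB; [exact: cvg_id | exact: cvg_cst].
  exact: (cvgM (cvgM H H) (cvg_cst (2 * gam)^-1)).
have lPhi : lsc_fun Phi by exact: lsc_addr.
(* Completing the square: the affine minorant plus the quadratic equals [c1] plus a parabola centred
   at [b], so sublevel sets of [Phi] are bounded. *)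
pose b := a - gam *: v0.
pose c1 := inner v0 a + c - gam / 2 * inner v0 v0.
have qE w : inner v0 w + c + q w = c1 + inner (w - b) (w - b) / (2 * gam).
  rewrite /q enorm_sqr /c1 /b !innerE (innerC w v0) (innerC w a) (innerC a v0).
  by field; rewrite gt_eqF.
have lowb w : ((c1 + inner (w - b) (w - b) / (2 * gam))%:E <= Phi w)%E.
  by rewrite -qE EFinD; exact: leeD2r.
have [M0 M0E] : exists M0 : R, Phi w0 = M0%:E.
  rewrite /Phi; move: w0oo (phiNoo w0); case: (phi w0) => [r||]// _ _.
  by exists (r + q w0).
pose E := [set r : R | exists w, Phi w = r%:E].
have Elb r : E r -> c1 <= r.
  move=> [w Ew]; have := lowb w; rewrite Ew lee_fin; apply: le_trans.
  by rewrite lerDl divr_ge0 ?inner_ge0// mulr_ge0// ltW.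
have hE : has_inf E.
  by split; [exists M0, w0 | exists c1 => r /Elb].
pose m := inf E.
have mE r : E r -> m <= r by move=> Er; apply: ge_inf => //; case: hE.
have mPhi w : (m%:E <= Phi w)%E.
  have := lowb w; case Ew : (Phi w) => [r| |] //= _; last by rewrite leey.
  by rewrite lee_fin; apply: mE; exists w.
have [[w1 Pw]|/forallNP nomin] := pselect (exists w, Phi w = m%:E).
  exists w1; move=> w'; have := mPhi w'; rewrite -Pw; exact.
have mltPhi w : (m%:E < Phi w)%E.
  by rewrite lt_neqAle mPhi andbT; apply/eqP => H; apply: (nomin w); rewrite H.
(* The ball contains every point where [Phi] is at most [M0]. Were the infimum [m] not attained,
   [Phi] would exceed [m + e] on all of it, although values below both [m + e] and [M0] exist. *)
have [e e0 gap] := lsc_compact_gap lPhi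
  (@compact_ball R n b (Num.sqrt (2 * gam * (M0 - c1)))) (fun w _ => mltPhi w).
have mM0 : m < M0 by rewrite -lte_fin -M0E.
have ME : m < Num.min (m + e) M0 by rewrite lt_min mM0 andbT ltrDl.
have [r [w wr]] := inf_lt hE.1 ME.
rewrite lt_min => /andP[rme rM0].
have := gap w; rewrite wr lte_fin ltNge (ltW rme) /= => H.
exfalso; suff /H : enorm (w - b) <= Num.sqrt (2 * gam * (M0 - c1)) by [].
have := lowb w; rewrite wr lee_fin => lw.
rewrite ler_sqrt; last by rewrite !mulr_ge0 ?subr_ge0 ?Elb ?ltW//; exists w0.
rewrite -ler_pdivrMl; last by rewrite mulr_gt0.
rewrite mulrC; lra.
Qed.

(** First-order optimality: [w] is compared with [t w' + (1 - t) w], where convexity bounds [phi];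
    the quadratic leaves an error of order [t^2], which disappears after division by [t]. *)
Lemma prox_subdiff phi gam a w :
  proper_fun phi -> convex_fun phi -> 0 < gam -> is_prox phi gam a w ->
  subdiff phi w (gam^-1 *: (a - w)).
Proof.
move=> [[w0 w0oo] phiNoo] cphi g0 pw.
have [r rE] : exists r : R, phi w = r%:E.
  have := pw w0; move: w0oo (phiNoo w0) (phiNoo w).
  by case: (phi w0) => // s _ _; case: (phi w) => // r _ _; exists r.
move=> w'; rewrite rE subr0.
case w'E : (phi w') => [r'| |]; rewrite ?leey//; last by have := phiNoo w'; rewrite w'E.
rewrite -EFinD lee_fin -subr_ge0.
apply: (@ge0_small _ (inner (w' - w) (w' - w) / (2 * gam))) => t t01.
have := cphi w' w t t01; rewrite w'E rE -!EFinM -EFinD => ct.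
have := le_trans (pw (t *: w' + (1 - t) *: w)) (leeD ct (lexx _)).
rewrite rE -!EFinD lee_fin !enorm_sqr.
have -> : t *: w' + (1 - t) *: w - a = t *: (w' - w) - (a - w).
  by apply/colP => i; rewrite !mxE; ring.
have -> : w - a = - (a - w) by rewrite opprB.
move: (w' - w) (a - w) => d e; rewrite !innerE (innerC e d) => H.
have [t0 _] := andP t01.
have -> : gam^-1 = 2 * (2 * gam)^-1 by field; rewrite gt_eqF.
by rewrite -(ler_pM2l t0); move: (2 * gam)^-1 H => k; lra.
Qed.

(** The equality case of Fenchel's inequality: the subgradient inequality says that the supremum is
    attained at [w]. *)
Lemma fconj_subdiff phi w z (r : R) :
  proper_fun phi -> subdiff phi w z -> phi w = r%:E -> fconj phi z = (inner z w - r)%:E.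
Proof.
move=> [_ phiNoo] zw wr; apply/eqP; rewrite eq_le; apply/andP; split.
  apply: ge_ereal_sup => _ [v _ <-].
  case vE : (phi v) => [s| |]; last by have := phiNoo v; rewrite vE.
    rewrite -EFinB lee_fin; have := subdiff_ler zw wr vE.
    rewrite innerBr; lra.
  by rewrite leNye.
by apply: ereal_sup_ubound; exists w => //; rewrite wr.
Qed.

Lemma fconj_ge phi w z (r : R) : phi w = r%:E -> ((inner z w - r)%:E <= fconj phi z)%E.
Proof. by move=> wr; apply: ereal_sup_ubound; exists w => //; rewrite wr. Qed.

(** Fenchel's inequality at [p] and its equality case at [z] show that the dual objective at [p]
    exceeds the one at [z] by at least [gam / 2] times the square of |p - z|; minimality of [p] then
    forces [p = z]. *)
Lemma conj_prox_unique phi gam a w z p :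
  proper_fun phi -> 0 < gam -> subdiff phi w z -> a = w + gam *: z ->
  is_prox (fconj phi) gam^-1 (gam^-1 *: a) p -> p = z.
Proof.
move=> pphi g0 zw aE /(_ z).
have [r wr] := subdiff_dom pphi zw.
rewrite (fconj_subdiff pphi zw wr).
have /leeD/(_ (lexx (enorm (p - gam^-1 *: a) ^+ 2 / (2 * gam^-1))%:E)) := fconj_ge p wr.
move=> H1 H2; apply: subr0_eq; have := le_trans H1 H2.
rewrite -!EFinD lee_fin !enorm_sqr.
have -> : p - gam^-1 *: a = (p - z) - gam^-1 *: w.
  rewrite aE scalerDr scalerA mulVf ?gt_eqF// scale1r.
  by apply/colP => i; rewrite !mxE; ring.
have -> : z - gam^-1 *: a = - (gam^-1 *: w).
  rewrite aE scalerDr scalerA mulVf ?gt_eqF// scale1r.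
  by apply/colP => i; rewrite !mxE; ring.
have -> : inner p w = inner (p - z) w + inner z w by rewrite innerBl subrK.
move: (p - z) => d.
rewrite !innerE (innerC w d) -subr_ge0.
match goal with |- is_true (0 <= ?X) -> _ =>
  have -> : X = - (gam / 2) * inner d d by field; rewrite gt_eqF end.
rewrite mulNr oppr_ge0 pmulr_rle0 ?divr_gt0//; exact: inner_self_eq0.
Qed.

End Moreau.

(** * Local boundedness and Lipschitz continuity of convex functions *)

Section ConvexBounds.
Context {R : realType} {n : nat}.
Variable phi : 'cV[R]_n -> \bar R.
Hypotheses (pphi : proper_fun phi) (cphi : convex_fun phi).

Lemma convex_le a b (t : R) (c : R) : 0 <= t <= 1 ->
  (phi a <= c%:E)%E -> (phi b <= c%:E)%E -> (phi (t *: a + (1 - t) *: b) <= c%:E)%E.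
Proof.
move=> /andP[t0 t1] ac bc.
have [->|tn0] := eqVneq t 0; first by rewrite scale0r add0r subr0 scale1r.
have [->|tn1] := eqVneq t 1; first by rewrite subrr scale0r addr0 scale1r.
have t01 : 0 < t < 1 by rewrite !lt_neqAle t0 t1 tn1 eq_sym tn0.
apply: (le_trans (cphi a b t01)).
have -> : c%:E = (t%:E * c%:E + (1 - t)%:E * c%:E)%E.
  by rewrite -!EFinM -EFinD; congr EFin; ring.
by apply: leeD; apply: lee_wpmul2l; rewrite ?lee_fin ?subr_ge0.
Qed.

(** Induction on the number [k] of coordinates in which the displacement may be nonzero; each new
    coordinate costs at least a halving of the radius. *)
Lemma convex_upper_bound w0 : interior (edom phi) w0 ->
  exists (r C : R), 0 < r /\
    forall d : 'cV[R]_n, (forall i, `|d i 0| <= r) -> (phi (w0 + d)%R <= C%:E)%E.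
Proof.
move=> /nbhs_enormP[rho rho0 rhodom].
have fin w : edom phi w -> exists c : R, phi w = c%:E.
  rewrite /edom /=; have := pphi.2 w.
  by case: (phi w) => // c _ _; exists c.
suff H k : (k <= n)%N -> exists (r C : R), 0 < r /\
    forall d : 'cV[R]_n, (forall i, `|d i 0| <= r) -> (forall i : 'I_n, (k <= i)%N -> d i 0 = 0) ->
      (phi (w0 + d)%R <= C%:E)%E.
  have [r [C [r0 HC]]] := H n (leqnn n).
  exists r, C; split => // d dr; apply: HC => // i.
  by rewrite leqNgt ltn_ord.
elim: k => [_|k IH kn].
  have [c w0c] : exists c : R, phi w0 = c%:E.
    by apply: fin; apply: rhodom; rewrite subrr enorm0.
  exists 1, c; split => // d _ d0.
  by rewrite (_ : d = 0) ?addr0 ?w0c//; apply/colP => i; rewrite d0 ?mxE.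
have [r [C [r0 HC]]] := IH (ltnW kn).
pose i0 := Ordinal kn; pose e : 'cV[R]_n := delta_mx i0 0.
have e1 : enorm e = 1.
  rewrite /enorm /inner (bigD1 i0)//= big1 ?addr0 => [|i ii0].
    by rewrite mxE !eqxx mulr1 sqrtr1.
  by rewrite mxE (negbTE ii0) mul0r.
have rh0 : 0 < rho / 2 by rewrite divr_gt0.
have endp (s : R) : `|s| <= rho / 2 -> exists c : R, phi (w0 + s *: e) = c%:E.
  move=> sr; apply: fin; apply: rhodom; rewrite addrAC subrr add0r enormZ e1 mulr1; lra.
have [cp cpE] : exists c : R, phi (w0 + (rho / 2) *: e) = c%:E.
  by apply: endp; rewrite ger0_norm// ltW.
have [cm cmE] : exists c : R, phi (w0 + (- (rho / 2)) *: e) = c%:E.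
  by apply: endp; rewrite normrN ger0_norm// ltW.
pose C' := Num.max C (Num.max cp cm).
exists (Num.min r (rho / 2) / 2), C'; split.
  by rewrite divr_gt0// lt_min r0.
move=> d dr d0.
have dr1 i : `|2 * d i 0| <= r.
  have := dr i; rewrite ler_pdivlMr// le_min => /andP[H _].
  by rewrite normrM ger0_norm// mulrC.
have dr2 : `|2 * d i0 0| <= rho / 2.
  have := dr i0; rewrite ler_pdivlMr// le_min => /andP[_ H].
  by rewrite normrM ger0_norm// mulrC.
(* A midpoint: one end has coordinate [i0] of the displacement erased, as the induction hypothesis
   demands, the other moves along [e] only. *)
have -> : w0 + d = (2^-1) *: (w0 + 2 *: (d - d i0 0 *: e))
    + (1 - 2^-1) *: (w0 + (2 * d i0 0) *: e).
  by apply/colP => i; rewrite !mxE; field.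
apply: convex_le; first by apply/andP; split; lra.
  apply: (@le_trans _ _ C%:E); last by rewrite lee_fin le_max lexx.
  apply: HC => i; rewrite !mxE eqxx andbT.
    case: eqVneq => [->|_]; last by rewrite /= mulr0 subr0.
    by rewrite mulr1 subrr mulr0 normr0 ltW.
  move=> ki; case: eqVneq => [->|ii0]; first by rewrite mulr1 subrr mulr0.
  have ki' : (k < i)%N.
    rewrite ltn_neqAle ki andbT.
    by apply: contra_neqN ii0 => /eqP ki0; apply: val_inj.
  by rewrite (d0 i)//= !(mulr0, subr0).
set s := 2 * d i0 0.
(* Along [e], the point lies between the two fixed ends at distance [rho / 2], where the values [cp]
   and [cm] are finite. *)
have -> : w0 + s *: e = ((s + rho / 2) / rho) *: (w0 + (rho / 2) *: e)
    + (1 - (s + rho / 2) / rho) *: (w0 + (- (rho / 2)) *: e).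
  by apply/colP => i; rewrite !mxE; field; rewrite gt_eqF.
move: dr2; rewrite ler_norml -/s => /andP[s1 s2].
apply: convex_le.
- apply/andP; split; last by rewrite ler_pdivrMr//; lra.
  by rewrite divr_ge0 ?(ltW rho0)//; lra.
- by rewrite cpE lee_fin !le_max lexx !orbT.
- by rewrite cmE lee_fin !le_max lexx !orbT.
Qed.

(** The lower bound comes from reflection: [w0] is the midpoint of [w] and [2 w0 - w], so an upper
    bound at the reflected point bounds [phi w] from below. *)
Lemma convex_local_bound w0 : interior (edom phi) w0 ->
  exists (r M : R), 0 < r /\ forall w, enorm (w - w0) < r ->
    exists2 c : R, phi w = c%:E & `|c| <= M.
Proof.
move=> w0dom; have [r [C [r0 HC]]] := convex_upper_bound w0dom.
have [c0 c0E] : exists c : R, phi w0 = c%:E.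
  have := interior_subset w0dom; rewrite /edom /=; have := pphi.2 w0.
  by case: (phi w0) => // c _ _; exists c.
exists r, (`|C| + 2 * `|c0|); split => // w wr.
have up : (phi w <= C%:E)%E.
  rewrite -(subrKC w0 w); apply: HC => i.
  exact: le_trans (coord_le_enorm _ _) (ltW wr).
have up' : (phi (w0 - (w - w0))%R <= C%:E)%E.
  apply: HC => i; rewrite mxE normrN.
  exact: le_trans (coord_le_enorm _ _) (ltW wr).
have h2 : 0 < (2^-1 : R) < 1 by lra.
have := cphi w (w0 - (w - w0)) h2.
have -> : 2^-1 *: w + (1 - 2^-1) *: (w0 - (w - w0)) = w0.
  by apply/colP => i; rewrite !mxE; field.
move: up up' (pphi.2 w) (pphi.2 (w0 - (w - w0))).
case: (phi w) => // c; case: (phi (w0 - (w - w0))) => // c'.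
rewrite !lee_fin => cC c'C _ _.
rewrite c0E -!EFinM -EFinD lee_fin => H; exists c => //.
have := ler_norm C; have := ler_norm (- c0); rewrite normrN => h3 h4.
have := normr_ge0 c0; rewrite ler_norml; lra.
Qed.

Variable E : set 'cV[R]_n.
Hypotheses (cE : compact E) (Edom : E `<=` interior (edom phi)).

(** One number [M] serves as bound and, inverted, as radius. Both requirements relax as [M] grows,
    so the covering form of compactness applies along [+oo]. *)
Lemma convex_bound_compact : exists2 M : R, 0 < M &
  forall w w', E w -> enorm (w' - w) <= M^-1 ->
    exists2 c : R, phi w' = c%:E & `|c| <= M.
Proof.
have := cE; move=> /compact_near_coveringP cE'.
have := cE' R +oo (fun M w => forall w', enorm (w' - w) <= M^-1 ->
    exists2 c : R, phi w' = c%:E & `|c| <= M) _.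
move=> /(_ _)[w Ew|M0 [_ HM]].
  have [r [C [r0 HC]]] := convex_local_bound (Edom Ew).
  exists ([set w' | enorm (w' - w) < r / 2], [set M | 2 / r < M /\ C <= M]) => /=.
    split; first by apply/nbhs_enormP; exists (r / 2); rewrite ?divr_gt0.
    near=> M; split; first by near: M; apply: nbhs_pinfty_gt; rewrite num_real.
    by near: M; apply: nbhs_pinfty_ge; rewrite num_real.
  move=> [w' M] /= [w'w [rM CM]] w'' w''w'.
  have M0 : 0 < M by apply: lt_trans rM; rewrite divr_gt0.
  have Mr : M^-1 < r / 2.
    by rewrite -[r / 2]invrK invf_div ltf_pV2// posrE divr_gt0.
  have [|c cE2 cC] := HC w''; last by exists c => //; exact: le_trans cC CM.
  have -> : w'' - w = (w'' - w') + (w' - w) by rewrite addrA subrK.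
  by apply: (le_lt_trans (enormD _ _)); lra.
exists (Num.max M0 0 + 1) => [|w w' Ew].
  by rewrite ltr_pwDr// le_max lexx orbT.
apply: (HM (Num.max M0 0 + 1)) => //.
by rewrite ltr_pwDr// le_max lexx.
Unshelve. all: by end_near. Qed.

(** A subgradient is tested in its own direction with step length [M^-1]: the gain |v| / M is at
    most the variation [2 * M] of [phi]. *)
Lemma subdiff_bound_compact : exists B : R, forall w v, E w -> subdiff phi w v ->
  enorm v <= B.
Proof.
have [M M0 HM] := convex_bound_compact.
exists (M * (2 * M)) => w v Ew wv.
have [v0|v0] := eqVneq (enorm v) 0.
  by rewrite v0 !mulr_ge0// ltW.
have vp : 0 < enorm v by rewrite lt_neqAle eq_sym v0 enorm_ge0.
pose d := (M^-1 / enorm v) *: v.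
have dE : enorm d = M^-1.
  by rewrite enormZ ger0_norm ?mulfVK// divr_ge0 ?enorm_ge0// invr_ge0 ltW.
have [|c cE1 cM] := HM w w Ew; first by rewrite subrr enorm0 invr_ge0 ltW.
have [|c' c'E c'M] := HM w (w + d) Ew; first by rewrite addrAC subrr add0r dE.
have := subdiff_ler wv cE1 c'E; rewrite addrAC subrr add0r innerZr -enorm_sqr.
have -> : M^-1 / enorm v * enorm v ^+ 2 = enorm v / M.
  by field; rewrite gt_eqF//= gt_eqF.
rewrite -ler_pdivrMl// mulrC.
move: cM c'M; rewrite !ler_norml => /andP[? ?] /andP[? ?]; lra.
Qed.

(** The segment from [w'] to [w] is prolonged by [M^-1] beyond [w]. Then [w] is a convex combination
    with weight [t <= M * D] on the far end, while values differ by at most [2 * M]. *)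
Lemma convex_lipschitz_compact : exists2 k : R, 0 < k &
  forall w w', E w -> E w' -> `|fine (phi w) - fine (phi w')| <= k * enorm (w - w').
Proof.
have [M M0 HM] := convex_bound_compact.
exists (M * (2 * M)) => [|w w' Ew Ew']; first by rewrite !mulr_gt0.
suff {w w' Ew Ew'} H w w' : E w -> E w' ->
    fine (phi w) - fine (phi w') <= M * (2 * M) * enorm (w - w').
  by rewrite ler_norml H// andbT lerNl opprB enormB H.
move=> Ew Ew'.
have [ww0|ww0] := eqVneq (enorm (w - w')) 0.
  by rewrite (subr0_eq (enorm_eq0 ww0)) subrr subrr enorm0 mulr0.
set D := enorm (w - w') in ww0 *.
have Dp : 0 < D by rewrite lt_neqAle eq_sym ww0 enorm_ge0.
pose d := (M^-1 / D) *: (w - w').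
have dE : enorm d = M^-1.
  by rewrite enormZ ger0_norm ?mulfVK// divr_ge0 ?enorm_ge0// invr_ge0 ltW.
have M10 : enorm (0 : 'cV[R]_n) <= M^-1 by rewrite enorm0 invr_ge0 ltW.
have [|c cE1 cM] := HM w w Ew; first by rewrite subrr.
have [|c' c'E c'M] := HM w' w' Ew'; first by rewrite subrr.
have [|c2 c2E c2M] := HM w (w + d) Ew; first by rewrite addrAC subrr add0r dE.
pose t := D / (D + M^-1).
have S0 : 0 < D + M^-1 by rewrite addr_gt0// invr_gt0.
have t01 : 0 < t < 1.
  by rewrite divr_gt0//= ltr_pdivrMr// mul1r ltrDl invr_gt0.
have := cphi (w + d) w' t01.
have -> : t *: (w + d) + (1 - t) *: w' = w.
  have tk : t * (1 + M^-1 / D) = 1.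
    have -> : 1 + M^-1 / D = (D + M^-1) / D by rewrite mulrDl divff.
    by rewrite /t mulrA divfK ?divff// gt_eqF.
  apply/colP => i; rewrite !mxE; move: (M^-1 / D) tk => l tk.
  transitivity (w' i 0 + t * (1 + l) * (w i 0 - w' i 0)); first by ring.
  by rewrite tk mul1r addrC subrK.
rewrite cE1 c2E c'E -!EFinM -EFinD lee_fin /= => H.
have tM : t <= M * D.
  rewrite /t ler_pdivrMr// mulrDr.
  have -> : M * D * M^-1 = D by field; rewrite gt_eqF.
  by rewrite lerDr !mulr_ge0 ?ltW.
move: cM c'M c2M; rewrite !ler_norml => /andP[? ?] /andP[? ?] /andP[? ?].
have [t0 _] := andP t01.
have -> : M * (2 * M) * D = (M * D) * (2 * M) by ring.
apply: (@le_trans _ _ (t * (2 * M))); last by rewrite ler_wpM2r// mulr_ge0// ltW.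
apply: (@le_trans _ _ (t * (c2 - c'))); first by lra.
by rewrite ler_wpM2l ?(ltW t0)//; lra.
Qed.

End ConvexBounds.

(** * The Moreau envelope and its dual map *)

Section Envelope.
Context {R : realType} {s : nat}.
Variables (g : 'cV[R]_s -> \bar R) (gam : R).
Hypotheses (pg : proper_fun g) (gam0 : 0 < gam).

Lemma prox_map_exists : convex_fun g -> lsc_fun g -> (exists w v, subdiff g w v) ->
  exists zp : 'cV[R]_s -> 'cV[R]_s, forall a, subdiff g (a - gam *: zp a) (zp a).
Proof.
move=> cg lg [w0 [v0 wv0]].
have [r0 r0E] := subdiff_dom pg wv0.
(* A single subgradient supplies the affine minorant that makes the prox objective coercive. *)
have minor w : ((inner v0 w + (r0 - inner v0 w0))%:E <= g w)%E.
  have := wv0 w; rewrite r0E -EFinD innerBr subr0; congr (is_true (_%:E <= _)%E).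
  by rewrite addrCA.
have H a : exists z, subdiff g (a - gam *: z) z.
  have [w pw] := prox_exists a pg lg minor gam0.
  exists (gam^-1 *: (a - w)); rewrite scalerA mulfV ?gt_eqF// scale1r subKr.
  exact: prox_subdiff.
by have [zp zpP] := choice H; exists zp.
Qed.

Variable zp : 'cV[R]_s -> 'cV[R]_s.
Hypothesis zpP : forall a, subdiff g (a - gam *: zp a) (zp a).

(** The objective [g w] + |w - a|^2 / (2 gam) at [w = a - gam *: zp a]; [fine] loses nothing, since
    [g] has a subgradient there. *)
Definition envelope a : R :=
  fine (g (a - gam *: zp a)) + gam / 2 * inner (zp a) (zp a).

Lemma envelope_fin a :
  g (a - gam *: zp a) = (envelope a - gam / 2 * inner (zp a) (zp a))%:E.
Proof.
by have [r rE] := subdiff_dom pg (zpP a); rewrite /envelope rE /= addrK.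
Qed.

Lemma prox_conj_eq a p : is_prox (fconj g) gam^-1 (gam^-1 *: a) p -> p = zp a.
Proof. by apply: (conj_prox_unique pg gam0 (zpP a)); rewrite subrK. Qed.

(** The subgradient inequality of [g] at the prox point of [b], tested at the prox point of [a]. The
    negative square is what later yields smoothness and the Lipschitz bound for [zp]. *)
Lemma envelope_le a b : envelope b <=
  envelope a + inner (zp b) (b - a) - gam / 2 * inner (zp b - zp a) (zp b - zp a).
Proof.
have := subdiff_ler (zpP b) (envelope_fin b) (envelope_fin a).
have -> : a - gam *: zp a - (b - gam *: zp b) = - (b - a) + gam *: (zp b - zp a).
  by apply/colP => i; rewrite !mxE; ring.
rewrite !innerE (innerC (zp a) (zp b)); lra.
Qed.

(** [envelope_le] and its mirror image are added; the envelope values cancel. *)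
Lemma prox_map_monotone a b :
  gam * inner (zp b - zp a) (zp b - zp a) <= inner (zp b - zp a) (b - a).
Proof.
have := envelope_le a b; have := envelope_le b a.
have -> : zp a - zp b = - (zp b - zp a) by rewrite opprB.
have -> : a - b = - (b - a) by rewrite opprB.
rewrite (innerBl (zp b) (zp a) (b - a)) !innerNl !innerNr; lra.
Qed.

(** Replacing [zp b] by [zp a] costs a cross term; Young's inequality with constant [gam] splits it
    so that the negative square of [envelope_le] absorbs one half. *)
Lemma envelope_descent a b : envelope b <=
  envelope a + inner (zp a) (b - a) + inner (b - a) (b - a) / (2 * gam).
Proof.
have H := envelope_le a b.
have := inner_young (zp b - zp a) (b - a) gam0.
rewrite (innerBl (zp b) (zp a) (b - a)); lra.
Qed.

Lemma prox_map_lipschitz a b : gam * enorm (zp b - zp a) <= enorm (b - a).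
Proof.
have := le_trans (prox_map_monotone a b) (inner_le_enorm _ _).
rewrite -enorm_sqr expr2 [gam * _]mulrA [leRHS]mulrC.
have [->|n0] := eqVneq (enorm (zp b - zp a)) 0; first by move=> _; rewrite mulr0 enorm_ge0.
by rewrite ler_pM2r// lt_neqAle eq_sym n0 enorm_ge0.
Qed.

Section cvg.
Context {I : Type} {F : set_system I} {FF : Filter F}.

Lemma prox_map_cvg (u : I -> 'cV[R]_s) (a : 'cV[R]_s) : u @ F --> a -> zp (u k) @[k --> F] --> zp a.
Proof.
move=> /cvg_enormB0 ua; apply: enormB0_cvg.
apply: (@cvg0_le _ _ F _ _ (fun k => gam^-1 * enorm (u k - a))).
  apply: nearW => k; rewrite ger0_norm ?enorm_ge0// ler_pdivlMl//.
  exact: prox_map_lipschitz.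
by rewrite -(mulr0 gam^-1); apply: cvgM => //; exact: cvg_cst.
Qed.

Lemma envelope_cvg (u : I -> 'cV[R]_s) (a : 'cV[R]_s) :
  u @ F --> a -> envelope (u k) @[k --> F] --> envelope a.
Proof.
move=> ua; have za := prox_map_cvg ua.
have ua0 : (fun k => u k - a) @ F --> (0 : 'cV[R]_s).
  by rewrite -(subrr a); apply: cvgB => //; exact: cvg_cst.
apply: (@squeeze_cvgr _ _ _ _ (fun k => envelope a + inner (zp a) (u k - a))
  (fun k => envelope a + inner (zp (u k)) (u k - a))).
- apply: nearW => k; apply/andP; split.
    have := envelope_le (u k) a; have := inner_ge0 (zp a - zp (u k)).
    rewrite -[u k - a]opprB innerNr => /(mulr_ge0 (divr_ge0 (ltW gam0) (ler0n R 2))); lra.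
  have := envelope_le a (u k); have := inner_ge0 (zp (u k) - zp a).
  by move=> /(mulr_ge0 (divr_ge0 (ltW gam0) (ler0n R 2))); lra.
- rewrite -[X in _ --> X]addr0 -(inner0r (zp a)).
  by apply: cvgD; [exact: cvg_cst | apply: cvg_inner => //; exact: cvg_cst].
- rewrite -[X in _ --> X]addr0 -(inner0r (zp a)).
  by apply: cvgD; [exact: cvg_cst | exact: cvg_inner].
Qed.

End cvg.

(** Equality in Fenchel's inequality at [zp (A *m x)] turns the dual expression in [Psi] into the
    primal envelope value. *)
Lemma envelope_Psi n (A : 'M[R]_(s, n)) (h : 'cV[R]_n -> R) (S : set 'cV[R]_n) x u d :
  S x -> Psi A g h S x (zp (A *m x)) u d gam =
    (envelope (A *m x) + h x + d / 2 * inner (x - u) (x - u))%:E.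
Proof.
move=> Sx; rewrite /Psi (fconj_subdiff pg (zpP _) (envelope_fin _)).
rewrite /Defs.indic (mem_set Sx) adde0 -!EFinB -!EFinD !enorm_sqr; congr EFin.
by rewrite (innerBr _ _ (zp _)) innerZr; field.
Qed.

End Envelope.

(** * One step of the algorithm *)

Section Algorithm.
Context {R : realType} {n s p : nat}.
Variables (S : set 'cV[R]_n) (A : 'M[R]_(s, n)) (K : 'M[R]_(p, n)).
Variables (g : 'cV[R]_s -> \bar R) (h : 'cV[R]_n -> R) (gradh : 'cV[R]_n -> 'cV[R]_n).
Variables (f : 'cV[R]_p -> \bar R) (O : set 'cV[R]_n) (Lh nu beta gam : R).
Variable zp : 'cV[R]_s -> 'cV[R]_s.
Hypotheses (Sconv : convex_set_cv S) (Scomp : compact S).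
Hypotheses (pg : proper_fun g) (gam0 : 0 < gam).
Hypothesis zpP : forall a, subdiff g (a - gam *: zp a) (zp a).
Hypotheses (SO : S `<=` O) (Oh : forall v, O v -> is_grad h v (gradh v)).
Hypothesis OL : forall v w, O v -> O w ->
  enorm (gradh v - gradh w) <= Lh * enorm (v - w).
Hypotheses (pf : proper_fun f) (cf : convex_fun f).
Hypothesis Kdom : forall v, S v -> interior (edom f) (K *m v).
Hypotheses (nu0 : 0 < nu) (Lh0 : 0 <= Lh) (beta02 : 0 < beta < 2).

Let env := envelope g gam zp.
Let F (v : 'cV[R]_n) : R := fine (f (K *m v)).
Let dlt := 2 * nu + Lh + 2 * opnorm A ^+ 2 / gam.

Lemma fK_fin v : S v -> f (K *m v) = (F v)%:E.
Proof.
move=> /Kdom/interior_subset; rewrite /edom /F /=; have := pf.2 (K *m v).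
by case: (f (K *m v)) => [r||].
Qed.

Lemma delta_gt0 : 0 < dlt.
Proof.
have : 0 <= 2 * opnorm A ^+ 2 / gam by rewrite divr_ge0 ?(ltW gam0)// mulr_ge0// sqr_ge0.
by have := nu0; have := Lh0; rewrite /dlt; lra.
Qed.

Lemma segment_in v w (t : R) : S v -> S w -> 0 <= t <= 1 -> O (v + t *: (w - v)).
Proof.
move=> Sv Sw t01; apply: SO.
have -> : v + t *: (w - v) = t *: w + (1 - t) *: v.
  by apply/colP => i; rewrite !mxE; ring.
exact: Sconv.
Qed.

(** The projection inequality is tested at [x0] and added to the descent inequalities of [h] and
    [env] and to the subgradient inequality of [f] multiplied by [th]: all first-order terms
    cancel. *)
Lemma iteration_descent x0 x1 u0 y th : S x0 -> 0 <= th -> subdiff f (K *m x0) y ->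
  is_proj S (u0 + (th / dlt) *: (K^T *m y) - dlt^-1 *: gradh x0
             - dlt^-1 *: (A^T *m zp (A *m x0))) x1 ->
  th * F x0 = env (A *m x0) + h x0 + dlt / 2 * inner (x0 - u0) (x0 - u0) ->
  env (A *m x1) + h x1 + dlt / 2 * inner (x1 - u0) (x1 - u0)
    <= th * F x1 - nu * inner (x1 - x0) (x1 - x0).
Proof.
move=> Sx0 th0 yf proj thF; have [Sx1 _] := proj.
have d0 := delta_gt0.
have V := proj_variational Sconv proj Sx0.
have hD := @descent R n h gradh Lh O x0 x1
  (fun t => @segment_in x0 x1 t Sx0 Sx1) Oh OL.
have eD := envelope_descent pg gam0 zpP (A *m x0) (A *m x1).
have fD := subdiff_ler yf (fK_fin Sx0) (fK_fin Sx1).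
have oD := opnorm_ub A (x1 - x0).
rewrite -mulmxBr in eD; rewrite -mulmxBr in fD.
have oD2 : inner (A *m (x1 - x0)) (A *m (x1 - x0)) / (2 * gam)
    <= opnorm A ^+ 2 / (2 * gam) * inner (x1 - x0) (x1 - x0).
  rewrite mulrAC ler_wpM2r ?invr_ge0 ?mulr_ge0 ?(ltW gam0)//.
  by rewrite -!enorm_sqr -exprMn ler_pXn2r// nnegrE ?(le_trans (enorm_ge0 _) oD)// enorm_ge0.
have thD := ler_wpM2l th0 fD.
have dE : dlt / 2 = nu + Lh / 2 + 2 * (opnorm A ^+ 2 / (2 * gam)).
  by rewrite /dlt; field; rewrite gt_eqF.
have o0 : 0 <= opnorm A ^+ 2 / (2 * gam) * inner (x1 - x0) (x1 - x0).
  by rewrite mulr_ge0 ?inner_ge0// divr_ge0 ?sqr_ge0// mulr_ge0// ltW.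
have V2 : dlt * inner (u0 - x1) (x0 - x1) <=
   inner (th *: (K^T *m y) - gradh x0 - A^T *m zp (A *m x0)) (x1 - x0).
  rewrite -subr_ge0.
  have -> : inner (th *: (K^T *m y) - gradh x0 - A^T *m zp (A *m x0)) (x1 - x0)
     - dlt * inner (u0 - x1) (x0 - x1) = - (dlt * inner (u0 + (th / dlt) *: (K^T *m y)
     - dlt^-1 *: gradh x0 - dlt^-1 *: (A^T *m zp (A *m x0)) - x1) (x0 - x1)).
    rewrite -(opprB x0 x1) innerNr -opprD -innerZl -innerDl -innerZl.
    congr (- inner _ _); apply/colP => i; rewrite !mxE; field; exact: lt0r_neq0.
  by rewrite oppr_ge0 pmulr_rle0.
(* The three-point identity; its term in [x1 - x0] pays for the two descent lemmas. *)
have V3 : dlt * inner (u0 - x1) (x0 - x1) = dlt / 2 * (inner (x1 - u0) (x1 - u0)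
    + inner (x1 - x0) (x1 - x0) - inner (x0 - u0) (x0 - u0)).
  by rewrite !innerE (innerC x1 u0) (innerC x1 x0) (innerC x0 u0); field.
rewrite V3 in V2.
have V4 d : inner (th *: (K^T *m y) - gradh x0 - A^T *m zp (A *m x0)) d =
    th * inner y (K *m d) - inner (gradh x0) d - inner (zp (A *m x0)) (A *m d).
  by rewrite !innerBl innerZl !inner_mul !trmxK.
rewrite V4 in V2.
move: V2 hD eD oD2 thD o0 thF; rewrite -/env !mulrDr dE.
by move: (opnorm A ^+ 2 / (2 * gam)) => c; lra.
Qed.

(** * Asymptotics of the iterates once the parameters are constant, from index [N] on *)

Variables (x u : nat -> 'cV[R]_n) (y : nat -> 'cV[R]_p) (theta : nat -> R) (N : nat).
Variables (m0 M0 : R).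
Hypotheses (xS : forall k, S (x k)) (theta0 : forall k, 0 <= theta k).
Hypothesis ysub : forall k, subdiff f (K *m x k) (y k.+1).
Hypothesis urec : forall k, u k.+1 = (1 - beta) *: u k + beta *: x k.+1.
Hypothesis xproj : forall k, (N <= k)%N ->
  is_proj S (u k + (theta k / dlt) *: (K^T *m y k.+1) - dlt^-1 *: gradh (x k)
             - dlt^-1 *: (A^T *m zp (A *m x k))) (x k.+1).
Hypothesis thetaE : forall k, (N <= k)%N ->
  theta k * F (x k) = env (A *m x k) + h (x k) + dlt / 2 * inner (x k - u k) (x k - u k).
Hypotheses (m00 : 0 < m0) (Fbnd : forall v, S v -> m0 <= F v <= M0).

Lemma u_gap k : x k.+1 - u k.+1 = (1 - beta) *: (x k.+1 - u k).
Proof. by rewrite urec; apply/colP => i; rewrite !mxE; ring. Qed.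

Lemma theta_decrease k : (N <= k)%N ->
  nu * inner (x k.+1 - x k) (x k.+1 - x k)
  + dlt / 2 * (beta * (2 - beta)) * inner (x k.+1 - u k) (x k.+1 - u k)
  <= (theta k - theta k.+1) * F (x k.+1).
Proof.
move=> Nk.
have := iteration_descent (xS k) (theta0 k) (ysub k) (xproj Nk) (thetaE Nk).
have := thetaE (leqW Nk); rewrite u_gap innerZl innerZr.
rewrite mulrBl; lra.
Qed.

Lemma decrease_coef_gt0 : 0 < dlt / 2 * (beta * (2 - beta)).
Proof.
have [b0 b2] := andP beta02.
by rewrite mulr_gt0 ?divr_gt0 ?delta_gt0// mulr_gt0// subr_gt0.
Qed.

Lemma F_gt0 v : S v -> 0 < F v.
Proof. by move=> /Fbnd/andP[mF _]; exact: lt_le_trans mF. Qed.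

Lemma theta_nonincreasing k : (N <= k)%N -> theta k.+1 <= theta k.
Proof.
move=> Nk; rewrite -subr_ge0 -(pmulr_lge0 _ (F_gt0 (xS k.+1))).
apply: le_trans (theta_decrease Nk).
by rewrite addr_ge0// mulr_ge0 ?inner_ge0// ltW// decrease_coef_gt0.
Qed.

Lemma theta_cvg : exists2 thb : R, 0 <= thb & theta @ \oo --> thb.
Proof.
pose v k := theta (k + N)%N.
have vni : nonincreasing_seq v.
  apply/nonincreasing_seqP => k; rewrite /v addSn.
  by apply: theta_nonincreasing; rewrite leq_addl.
have vlb : has_lbound (range v) by exists 0 => _ [k _ <-]; exact: theta0.
have vc := nonincreasing_cvgn vni vlb.
exists (inf (range v)).
  by apply: lb_le_inf; [exists (v 0%N), 0%N | move=> _ [k _ <-]; exact: theta0].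
by rewrite -(cvg_shiftn N).
Qed.

(** The squares are dominated by a constant times [theta k - theta k.+1], which vanishes because
    [theta] converges; no summation is required. *)
Lemma sqr_gap_cvg0 (c : R) (d : nat -> 'cV[R]_n) : 0 < c ->
  (forall k, (N <= k)%N -> c * inner (d k) (d k) <= (theta k - theta k.+1) * F (x k.+1)) ->
  enorm (d k) @[k --> \oo] --> 0.
Proof.
move=> c0 dk; have [thb _ thc] := theta_cvg.
have H : (fun k => inner (d k) (d k)) @ \oo --> (0 : R).
  apply: (@cvg0_le _ _ _ _ _ (fun k => (c^-1 * M0) * (theta k - theta k.+1))).
    near=> k; have Nk : (N <= k)%N by near: k; exact: nbhs_infty_ge.
    rewrite ger0_norm ?inner_ge0// -mulrA ler_pdivlMl// (le_trans (dk _ Nk))//.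
    rewrite mulrC ler_wpM2r ?subr_ge0 ?theta_nonincreasing//.
    by have /andP[] := Fbnd (xS k.+1).
  rewrite -(mulr0 (c^-1 * M0)) -(subrr thb); apply: cvgM; first exact: cvg_cst.
  by apply: cvgB => //; rewrite -(cvg_shiftS theta) in thc.
have := cvg_comp (fun k => inner (d k) (d k)) Num.sqrt H (@sqrt_continuous R 0).
by rewrite sqrtr0.
Unshelve. all: by end_near. Qed.

Lemma step_cvg0 : enorm (x k.+1 - x k) @[k --> \oo] --> 0.
Proof.
apply: (sqr_gap_cvg0 nu0) => k Nk; apply: le_trans (theta_decrease Nk).
by rewrite lerDl mulr_ge0 ?inner_ge0// ltW// decrease_coef_gt0.
Qed.

Lemma prox_step_cvg0 : enorm (x k.+1 - u k) @[k --> \oo] --> 0.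
Proof.
apply: (sqr_gap_cvg0 decrease_coef_gt0) => k Nk; apply: le_trans (theta_decrease Nk).
by rewrite lerDr mulr_ge0 ?inner_ge0// ltW.
Qed.

Lemma anchor_cvg0 : enorm (x k - u k) @[k --> \oo] --> 0.
Proof.
have H : (fun k => `|1 - beta| * enorm (x k.+1 - u k)) @ \oo --> `|1 - beta| * 0.
  exact: cvg_mulcl prox_step_cvg0.
rewrite mulr0 in H.
have H2 : (fun k => enorm (x k.+1 - u k.+1)) @ \oo --> (0:R).
  by apply: (cvg_near_eq H); apply: nearW => k; rewrite u_gap enormZ.
by rewrite -(cvg_shiftS (fun k => enorm (x k - u k))).
Qed.

Let KS := [set K *m v | v in S].

Lemma KS_compact : compact KS.
Proof.
apply: continuous_compact => //; apply: continuous_subspaceT => v.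
by apply: (@cvg_mulmx _ _ (nbhs v)); exact: cvg_id.
Qed.

Lemma KS_dom : KS `<=` interior (edom f).
Proof. by move=> _ [v Sv <-]; exact: Kdom. Qed.

(** [f] may be infinite away from K(S), so continuity is claimed within [S] only, where the
    Lipschitz bound on the compact K(S) gives it. *)
Lemma F_cvg (I : Type) (G : set_system I) (FG : Filter G) (w : I -> 'cV[R]_n) v :
  (forall i, S (w i)) -> S v -> w @ G --> v -> F (w i) @[i --> G] --> F v.
Proof.
move=> Sw Sv wv.
have [c c0 Hc] := convex_lipschitz_compact pf cf KS_compact KS_dom.
have H : (fun i => F (w i) - F v) @ G --> (0 : R).
  apply: (@cvg0_le _ _ _ _ _ (fun i => c * enorm (K *m w i - K *m v))).
    by apply: nearW => i; apply: Hc; [exists (w i) | exists v].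
  by rewrite -(mulr0 c); apply: cvg_mulcl; apply: cvg_enormB0; exact: cvg_mulmx.
have H' : (fun i => F (w i) - F v + F v) @ G --> F v.
  by rewrite -[X in _ --> X]add0r; apply: cvgD => //; exact: cvg_cst.
by apply: (cvg_near_eq H'); apply: nearW => i; rewrite subrK.
Qed.

Lemma y_bounded : exists B : R, forall k, enorm (y k.+1) <= B.
Proof.
have [B HB] := subdiff_bound_compact pf cf KS_compact KS_dom.
by exists B => k; apply: HB (ysub k); exists (x k).
Qed.

Lemma S_closed_cvg (w : nat -> 'cV[R]_n) v : (forall i, S (w i)) -> w @ \oo --> v -> S v.
Proof.
move=> Sw wv; have Sc : closed S by apply: compact_closed Scomp; exact: norm_hausdorff.
by apply: (@closed_cvg _ _ \oo _ w S Sc _ v wv); exact: nearW.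
Qed.

(** By Fenchel equality this is exactly the excess of the conjugate expression in (v) over f(Kx^k),
    so (v) reduces to [gap] tending to 0. *)
Let gap k := inner (y k.+1) (K *m (x k.+1 - x k)).

Lemma conj_gapE k :
  ((inner (K *m x k.+1) (y k.+1))%:E - fconj f (y k.+1))%E = (F (x k) + gap k)%:E.
Proof.
rewrite (fconj_subdiff pf (ysub k) (fK_fin (xS k))) -EFinB; congr EFin.
by rewrite /gap mulmxBr innerBr (innerC (K *m x k.+1)); ring.
Qed.

Lemma gap_cvg0 : gap @ \oo --> 0.
Proof.
have [B HB] := y_bounded.
apply: (@cvg0_le _ _ _ _ _ (fun k => B * opnorm K * enorm (x k.+1 - x k))).
  apply: nearW => k; apply: (le_trans (abs_inner_le _ _)).
  apply: (@le_trans _ _ (B * enorm (K *m (x k.+1 - x k)))).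
    by rewrite ler_wpM2r ?enorm_ge0.
  by rewrite -mulrA ler_wpM2l ?opnorm_ub// (le_trans (enorm_ge0 _) (HB 0%N)).
by rewrite -(mulr0 (B * opnorm K)); apply: cvg_mulcl; exact: step_cvg0.
Qed.

Lemma gap_le k : F (x k) + gap k <= F (x k.+1).
Proof. by rewrite /gap mulmxBr; exact: subdiff_ler (ysub k) (fK_fin _) (fK_fin _). Qed.

Lemma conj_ratio_cvg1 :
  (fun k => ediv ((inner (K *m x k.+1) (y k.+1))%:E - fconj f (y k.+1))%E
                 (f (K *m x k))) @ \oo --> 1%E.
Proof.
have H : (fun k => gap k / F (x k)) @ \oo --> (0 : R).
  apply: (@cvg0_le _ _ _ _ _ (fun k => m0^-1 * `|gap k|)).
    apply: nearW => k; have Fk := F_gt0 (xS k).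
    rewrite normrM normfV (gtr0_norm Fk) mulrC ler_wpM2r// lef_pV2 ?posrE//.
    by have /andP[] := Fbnd (xS k).
  rewrite -(mulr0 m0^-1); apply: cvg_mulcl; rewrite -(@normr0 _ R).
  exact: (cvg_norm gap_cvg0).
have H1 : (fun k => (1 + gap k / F (x k))%:E) @ \oo --> 1%E.
  apply: cvg_EFin; first exact: nearW.
  by rewrite -[X in _ --> X]addr0; apply: cvgD => //; exact: cvg_cst.
apply: (cvg_near_eq H1); apply: nearW => k.
rewrite conj_gapE /ediv -/(F (x k)) -EFinM; congr EFin.
by rewrite mulrDl divff// gt_eqF// F_gt0.
Qed.

(** * Limits along a subsequence *)

Variables (thb : R) (phi : nat -> nat) (xb : 'cV[R]_n).
Hypotheses (phik : forall k, (k <= phi k)%N) (xphi : (x \o phi) @ \oo --> xb).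
Hypothesis thetab : theta @ \oo --> thb.

Lemma limit_in : S xb.
Proof. by apply: S_closed_cvg xphi => k; exact: xS. Qed.

Lemma anchor_limit : (u \o phi) @ \oo --> xb.
Proof.
have H := cvg_subseq phik anchor_cvg0.
have H2 : (fun k => x (phi k) - u (phi k)) @ \oo --> (0 : 'cV[R]_n).
  by apply: enormB0_cvg; under eq_cvg do rewrite subr0.
have H3 : (fun k => x (phi k) - (x (phi k) - u (phi k))) @ \oo --> xb.
  by rewrite -[X in _ --> X]subr0; exact: cvgB.
by apply: (cvg_near_eq H3); apply: nearW => k; rewrite subKr.
Qed.

(** [ub] is left free for (iii), where the accumulation point provides it; for stationarity it is
    [xb], and the quadratic term drops out. *)
Lemma limit_value (ub : 'cV[R]_n) : (u \o phi) @ \oo --> ub ->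
  thb * F xb = env (A *m xb) + h xb + dlt / 2 * inner (xb - ub) (xb - ub).
Proof.
move=> uphi.
have HF : F (x (phi k)) @[k --> \oo] --> F xb.
  exact: (@F_cvg _ \oo _ (x \o phi) xb (fun k => xS (phi k)) limit_in xphi).
have L : (fun k => (theta \o phi) k * F (x (phi k))) @ \oo --> thb * F xb.
  by apply: cvgM => //; exact: cvg_subseq.
have He : env (A *m x (phi k)) @[k --> \oo] --> env (A *m xb).
  by apply: (envelope_cvg pg gam0 zpP); exact: cvg_mulmx.
have Hh : h (x (phi k)) @[k --> \oo] --> h xb.
  exact: (@grad_cvg R n nat \oo _ h xb _ (x \o phi) (Oh (SO limit_in)) xphi).
have xu : (fun k => x (phi k) - u (phi k)) @ \oo --> xb - ub by exact: cvgB.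
have Rr : (fun k => env (A *m x (phi k)) + h (x (phi k)) + dlt / 2 *
    inner (x (phi k) - u (phi k)) (x (phi k) - u (phi k))) @ \oo -->
    env (A *m xb) + h xb + dlt / 2 * inner (xb - ub) (xb - ub).
  by apply: cvgD; [exact: cvgD | apply: cvg_mulcl; exact: cvg_inner].
have E : (fun k => (theta \o phi) k * F (x (phi k))) @ \oo -->
    env (A *m xb) + h xb + dlt / 2 * inner (xb - ub) (xb - ub).
  apply: (cvg_near_eq Rr); near=> k.
  rewrite /= thetaE//; apply: (leq_trans _ (phik k)).
  by near: k; exact: nbhs_infty_ge.
exact: (cvg_unique (@norm_hausdorff _ R) L E).
Unshelve. all: by end_near. Qed.

Lemma gradh_cvg : gradh (x (phi k)) @[k --> \oo] --> gradh xb.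
Proof.
apply: enormB0_cvg.
apply: (@cvg0_le _ _ _ _ _ (fun k => Lh * enorm (x (phi k) - xb))).
  apply: nearW => k; rewrite ger0_norm ?enorm_ge0//.
  by apply: OL; apply: SO; [exact: xS | exact: limit_in].
by rewrite -(mulr0 Lh); apply: cvg_mulcl; exact: cvg_enormB0 xphi.
Qed.

Lemma limit_stationary : exists yb : 'cV[R]_p, subdiff f (K *m xb) yb /\
  subdiff (Defs.indic S) xb (thb *: (K^T *m yb) - gradh xb - A^T *m zp (A *m xb)).
Proof.
have [B HB] := y_bounded.
have yball k : [set w : 'cV[R]_p | enorm (w - 0) <= B] (y (phi k).+1).
  by rewrite /= subr0.
(* A further subsequence is needed for [y], read at the shifted index because [y k.+1] is a
   subgradient at the image of [x k]. *)
have [yb [psi [_ psik yc]]] := compact_subseq (@compact_ball R p 0 B) yball.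
pose chi k := phi (psi k).
have chik k : (k <= chi k)%N by exact: leq_trans (psik k) (phik _).
have xc : x (chi k) @[k --> \oo] --> xb by exact: cvg_subseq psik xphi.
have uc : u (chi k) @[k --> \oo] --> xb by exact: cvg_subseq psik anchor_limit.
have tc : theta (chi k) @[k --> \oo] --> thb by exact: cvg_subseq chik thetab.
have gc : gradh (x (chi k)) @[k --> \oo] --> gradh xb by exact: cvg_subseq psik gradh_cvg.
have zc : zp (A *m x (chi k)) @[k --> \oo] --> zp (A *m xb).
  by apply: (prox_map_cvg pg gam0 zpP); exact: cvg_mulmx.
have {}yc : y (chi k).+1 @[k --> \oo] --> yb by exact: yc.
have x1c : x (chi k).+1 @[k --> \oo] --> xb.
  have H : (fun k => x (chi k).+1 - x (chi k)) @ \oo --> (0 : 'cV[R]_n).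
    apply: enormB0_cvg; under eq_cvg do rewrite subr0.
    exact: cvg_subseq chik step_cvg0.
  have H3 : (fun k => x (chi k).+1 - x (chi k) + x (chi k)) @ \oo --> xb.
    by rewrite -[X in _ --> X]add0r; exact: cvgD.
  by apply: (cvg_near_eq H3); apply: nearW => k; rewrite subrK.
exists yb; split.
  move=> w'; rewrite (fK_fin limit_in).
  case w'E : (f w') => [r| |]; [| by rewrite leey | by have := pf.2 w'; rewrite w'E].
  rewrite -EFinD lee_fin subr0.
  have L : F (x (chi k)) + inner (y (chi k).+1) (w' - K *m x (chi k)) @[k --> \oo] -->
      F xb + inner yb (w' - K *m xb).
    apply: cvgD.
      exact: (@F_cvg _ \oo _ (fun k => x (chi k)) xb (fun k => xS (chi k)) limit_in xc).
    apply: cvg_inner => //; apply: cvgB; first exact: cvg_cst.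
    exact: cvg_mulmx.
  have Rc : (fun _ : nat => r) @ \oo --> r by exact: cvg_cst.
  apply: (ler_cvg_to L Rc); apply: nearW => k.
  exact: (subdiff_ler (ysub (chi k)) (fK_fin (xS _)) w'E).
move=> v; rewrite /Defs.indic (mem_set limit_in) add0e subr0.
case: ifPn => [/set_mem Sv|_]; last by rewrite leey.
rewrite lee_fin.
have L : inner (u (chi k) + (theta (chi k) / dlt) *: (K^T *m y (chi k).+1)
    - dlt^-1 *: gradh (x (chi k)) - dlt^-1 *: (A^T *m zp (A *m x (chi k)))
    - x (chi k).+1) (v - x (chi k).+1) @[k --> \oo] -->
  inner (xb + (thb / dlt) *: (K^T *m yb) - dlt^-1 *: gradh xb
    - dlt^-1 *: (A^T *m zp (A *m xb)) - xb) (v - xb).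
  apply: cvg_inner; last by apply: cvgB => //; exact: cvg_cst.
  apply: cvgB => //; apply: cvgB; last first.
    by apply: cvgZ; [exact: cvg_cst | exact: cvg_mulmx].
  apply: cvgB; last by apply: cvgZ => //; exact: cvg_cst.
  apply: cvgD => //; apply: cvgZ; last exact: cvg_mulmx.
  by apply: cvgM => //; exact: cvg_cst.
have Zc : (fun _ : nat => 0 : R) @ \oo --> (0 : R) by exact: cvg_cst.
have := ler_cvg_to L Zc.
have d0 := delta_gt0.
have -> : xb + (thb / dlt) *: (K^T *m yb) - dlt^-1 *: gradh xb
    - dlt^-1 *: (A^T *m zp (A *m xb)) - xb =
    dlt^-1 *: (thb *: (K^T *m yb) - gradh xb - A^T *m zp (A *m xb)).
  by apply/colP => i; rewrite !mxE; field; exact: lt0r_neq0.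
rewrite innerZl pmulr_rle0 ?invr_gt0//; apply; near=> k.
have Nk : (N <= chi k)%N.
  by apply: leq_trans (chik k); near: k; exact: nbhs_infty_ge.
exact: proj_variational Sconv (xproj Nk) _ Sv.
Unshelve. all: by end_near. Qed.

End Algorithm.

(** * From an exact subgradient nearby to an approximate one at the point *)

Section ProxEps.
Context {R : realType} {s : nat}.
Variables (g : 'cV[R]_s -> \bar R) (gam : R).
Hypotheses (pg : proper_fun g) (gam0 : 0 < gam).
Variable zp : 'cV[R]_s -> 'cV[R]_s.
Hypothesis zpP : forall a, subdiff g (a - gam *: zp a) (zp a).

Let env := envelope g gam zp.

Lemma envelope_le_fun a (ra : R) : g a = ra%:E ->
  env a + gam / 2 * inner (zp a) (zp a) <= ra.
Proof.
move=> raE; have := subdiff_ler (zpP a) (envelope_fin pg zpP a) raE.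
by rewrite opprD opprK addNKr innerZr -/env; lra.
Qed.

(** Moving the base point from [a - gam *: zp a] to [a] shifts the affine minorant; [e] has to cover
    its deficit at [a]. *)
Lemma prox_esubdiff a (ra e : R) : g a = ra%:E ->
  ra <= env a + gam / 2 * inner (zp a) (zp a) + e -> esubdiff g e a (zp a).
Proof.
move=> raE rae w'; rewrite raE.
have := zpP a w'; rewrite (envelope_fin pg zpP a).
case: (g w') => [r'| |]; [|by move=> _; rewrite leey|by []].
rewrite -!EFinD !lee_fin subr0 opprD opprK addrA innerDr innerZr -/env; lra.
Qed.

Lemma prox_esubdiff_lipschitz a (ra k e : R) : g a = ra%:E -> 0 < k ->
  ra - fine (g (a - gam *: zp a)) <= k * enorm (gam *: zp a) ->
  enorm (gam *: zp a) <= e -> gam / 2 * inner (zp a) (zp a) <= e ->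
  esubdiff g (2 * k * e) a (zp a) /\ `|env a - ra| <= (2 * k + 1) * e.
Proof.
move=> raE k0 Lip ze zze.
have zz0 : 0 <= gam / 2 * inner (zp a) (zp a).
  by rewrite mulr_ge0 ?inner_ge0// divr_ge0// ltW.
have e0 : 0 <= e := le_trans zz0 zze.
have ke : k * enorm (gam *: zp a) <= k * e by rewrite ler_wpM2l// ltW.
have ke0 : 0 <= k * e by rewrite mulr_ge0// ltW.
rewrite (envelope_fin pg zpP) /= -/env in Lip.
split; first by apply: (prox_esubdiff raE); lra.
have := envelope_le_fun raE; rewrite ler_norml; lra.
Qed.

(** A step in direction [z - d] with differentiation error |z - d| / 2 would contradict the
    subgradient inequality if [z] and [d] differed. *)
Lemma grad_subdiff w z d : (forall v, edom g v) ->
  is_grad (fun v => fine (g v)) w d -> subdiff g w z -> z = d.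
Proof.
move=> gdom gd wz; apply/subr0_eq/enorm_eq0/eqP.
have gfin v : g v = (fine (g v))%:E.
  by have := gdom v; rewrite /edom /=; have := pg.2 v; case: (g v).
case: eqVneq => [//|n0].
have np : 0 < enorm (z - d) by rewrite lt_neqAle eq_sym n0 enorm_ge0.
have e0 : 0 < enorm (z - d) / 2 by rewrite divr_gt0.
have [r [r0 H]] := gd _ e0.
pose t := r / (2 * enorm (z - d)).
have t0 : 0 < t by rewrite divr_gt0// mulr_gt0.
have tr : t * enorm (z - d) = r / 2 by rewrite /t; field.
have := H (t *: (z - d)); rewrite enormZ (gtr0_norm t0) tr => /(_ _) H2.
have /H2 : r / 2 < r by lra.
have := subdiff_ler wz (gfin w) (gfin (w + t *: (z - d))).
rewrite addrAC subrr add0r => H3 /(le_trans (ler_norm _)) H4.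
have H5 : inner z (t *: (z - d)) - inner d (t *: (z - d)) <= enorm (z - d) / 2 * (r / 2).
  by lra.
move: H5; rewrite -innerBl innerZr -enorm_sqr expr2 mulrA tr; nra.
Qed.

(** [zp a] is the gradient at the prox point, and [descent] from there to [a] has error at most
    [Lg * e ^+ 2 / 2]. The extra [e] in the value bound pays for [gam / 2 * inner (zp a) (zp a)]. *)
Lemma prox_esubdiff_smooth (gradg : 'cV[R]_s -> 'cV[R]_s) a (ra Lg e : R) :
  (forall w, edom g w) -> 0 < Lg ->
  (forall w, is_grad (fun w' => fine (g w')) w (gradg w)) ->
  (forall w w', enorm (gradg w - gradg w') <= Lg * enorm (w - w')) ->
  g a = ra%:E -> enorm (gam *: zp a) <= e -> gam / 2 * inner (zp a) (zp a) <= e ->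
  esubdiff g (Lg * e ^+ 2 / 2) a (zp a) /\ `|env a - ra| <= Lg * e ^+ 2 / 2 + e.
Proof.
move=> gdom Lg0 gg gL raE ze zze.
have zz0 : 0 <= gam / 2 * inner (zp a) (zp a).
  by rewrite mulr_ge0 ?inner_ge0// divr_ge0// ltW.
pose w := a - gam *: zp a.
have zE : gradg w = zp a by apply/esym; exact: grad_subdiff gdom (gg w) (zpP a).
have := @descent R s (fun v => fine (g v)) gradg Lg setT w a (fun _ _ => I)
  (fun v _ => gg v) (fun v v' _ _ => gL v v').
rewrite zE raE /w (envelope_fin pg zpP) /= opprD opprK addNKr -/env innerZr => D.
have e0 : 0 <= e := le_trans zz0 zze.
have ee : Lg / 2 * inner (gam *: zp a) (gam *: zp a) <= Lg * e ^+ 2 / 2.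
  rewrite [leRHS]mulrAC ler_wpM2l ?divr_ge0 ?(ltW Lg0)//.
  by rewrite -enorm_leP.
split; first by apply: (prox_esubdiff raE); lra.
have := envelope_le_fun raE; rewrite ler_norml.
have : 0 <= Lg * e ^+ 2 / 2 by rewrite divr_ge0// mulr_ge0 ?sqr_ge0// ltW.
lra.
Qed.

End ProxEps.

(** * Distance to a set *)

Section DistSet.
Context {R : realType} {n : nat}.
Variable E : set 'cV[R]_n.

Lemma dist_set_le w e : E e -> dist_set w E <= enorm (w - e).
Proof.
by move=> Ee; apply: ge_inf; [exists 0 => _ [v _ <-]; exact: enorm_ge0 | exists e].
Qed.

Lemma dist_set_lt w (r : R) : E !=set0 -> dist_set w E < r ->
  exists2 e, E e & enorm (w - e) < r.
Proof.
move=> [e0 Ee0] /inf_lt[|_ [e Ee <-] er]; last by exists e.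
by exists (enorm (w - e0)), e0.
Qed.

Lemma dist_set_lipschitz w w' : E !=set0 ->
  dist_set w E <= dist_set w' E + enorm (w - w').
Proof.
move=> E0; rewrite -lerBlDr; apply: lb_le_inf.
  by have [e Ee] := E0; exists (enorm (w' - e)), e.
move=> _ [e Ee <-]; rewrite lerBlDr (le_trans (dist_set_le w Ee))//.
have -> : w - e = (w' - e) + (w - w') by rewrite [RHS]addrC addrA subrK.
exact: enormD.
Qed.

Lemma dist_set_continuous : E !=set0 -> continuous (fun w => dist_set w E).
Proof.
move=> E0 w; apply/(@cvgrPdist_lt _ _ _ (nbhs (w : 'cV[R]_n))) => e e0.
apply/nbhs_enormP; exists e => // v vw; apply: le_lt_trans vw.
have h1 := dist_set_lipschitz v w E0; have h2 := dist_set_lipschitz w v E0.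
by rewrite ler_norml enormB; rewrite enormB in h1; lra.
Qed.

Lemma dist_set_compact (r : R) : E !=set0 -> compact E ->
  compact [set w | dist_set w E <= r].
Proof.
move=> E0 cE.
have [B EB] := compact_enorm_bounded cE.
apply: (@bounded_closed_cV_compact _ _ _ (r + 1 + B)) => [|w /= wr].
  apply: (@closed_comp _ _ (fun w => dist_set w E) [set t | t <= r]).
    by move=> w _; exact: dist_set_continuous.
  exact: closed_le.
(* The slack 1 yields a point of [E] without showing that the infimum is attained. *)
have [|e Ee we] := @dist_set_lt w (r + 1) E0; first by apply: (le_lt_trans wr); rewrite ltrDl.
rewrite -[w](subrK e); apply: (le_trans (enormD _ _)).
by rewrite lerD ?EB// ltW.
Qed.

End DistSet.

(** * Bounds on denominators and dual steps *)

Section Assembly.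
Context {R : realType}.

Lemma eventually_bounded (a : nat -> R) (B : R) :
  (\forall k \near \oo, a k <= B) -> exists C : R, forall k, a k <= C.
Proof.
move=> [N _ aB].
have [C HC] : exists C : R, forall k, (k < N)%N -> a k <= C.
  elim: N {aB} => [|N [C HC]]; first by exists 0.
  exists (Num.max C (a N)) => k; rewrite ltnS leq_eqVlt => /predU1P[->|/HC kC].
    by rewrite le_max lexx orbT.
  by rewrite le_max kC.
exists (Num.max B C) => k; rewrite le_max.
by case: (ltnP k N) => kN; [rewrite (HC _ kN) orbT | rewrite aB].
Qed.

Lemma denominator_bounds n p (S : set 'cV[R]_n) (K : 'M[R]_(p, n)) (f : 'cV[R]_p -> \bar R) :
  compact S -> proper_fun f -> convex_fun f -> lsc_fun f ->
  (forall v, S v -> interior (edom f) (K *m v)) -> (forall v, S v -> (0 < f (K *m v))%E) ->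
  exists m0 M0 : R, 0 < m0 /\ forall v, S v -> m0 <= fine (f (K *m v)) <= M0.
Proof.
move=> Sc pf cf lf Kdom fpos.
have KSc := KS_compact (K := K) Sc; have KSd := KS_dom Kdom.
have [|e e0 He] := lsc_compact_gap (m := 0) lf KSc; first by move=> _ [v Sv <-]; exact: fpos.
have [M M0 HM] := convex_bound_compact pf cf KSc KSd.
exists e, M; split => // v Sv.
have KSv : [set K *m v | v in S] (K *m v) by exists v.
have [|c cE cM] := HM (K *m v) (K *m v) KSv; first by rewrite subrr enorm0 invr_ge0 ltW.
have := He _ KSv; rewrite cE add0r lte_fin /= => /ltW ->.
exact: le_trans (ler_norm _) cM.
Qed.

Lemma envelope_PsiQ n s p (S : set 'cV[R]_n) (A : 'M[R]_(s, n)) (K : 'M[R]_(p, n))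
    (g : 'cV[R]_s -> \bar R) (h : 'cV[R]_n -> R) (f : 'cV[R]_p -> \bar R) (gam : R)
    (zp : 'cV[R]_s -> 'cV[R]_s) x u d :
  proper_fun g -> (forall a, subdiff g (a - gam *: zp a) (zp a)) -> S x ->
  PsiQ A K g h f S x (zp (A *m x)) u d gam =
  ((envelope g gam zp (A *m x) + h x + d / 2 * inner (x - u) (x - u))
     / fine (f (K *m x)))%:E.
Proof. by move=> pg zpP Sx; rewrite /PsiQ envelope_Psi. Qed.

(* A shrunk step size could never return to [gam], so no backtracking takes place. *)
Lemma backtrack_trivial (gam q : R) (b : bool) (j : nat) : 0 < gam -> 0 < q < 1 ->
  gam = (if b then gam * q ^+ j * q else gam * q ^+ j) -> gam * q ^+ j = gam.
Proof.
move=> g0 /andP[q0 q1]; case: b => // E.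
have qj : q ^+ j <= 1 by rewrite exprn_ile1 ?ltW.
have qj0 : 0 < q ^+ j by rewrite exprn_gt0.
have : gam * (q ^+ j * q) < gam.
  by rewrite gtr_pMr//; apply: le_lt_trans q1; rewrite ler_piMl// ltW.
by rewrite mulrA -E ltxx.
Qed.

(** The two entries of the minimum have separate purposes: the first bounds the distance to the prox
    point, the second the quadratic part of the envelope. *)
Lemma dual_step_bounds s (z : 'cV[R]_s) (gam eps : R) : 0 < gam -> 0 < eps ->
  enorm z <= Num.min (eps / gam) (Num.sqrt (2 * eps / gam)) ->
  enorm (gam *: z) <= eps /\ gam / 2 * inner z z <= eps.
Proof.
move=> g0 e0; rewrite le_min => /andP[z1 z2]; split.
  by rewrite enormZ gtr0_norm// mulrC -ler_pdivlMr.
have e2 : 0 <= 2 * eps / gam by rewrite divr_ge0 ?mulr_ge0 ?(ltW e0) ?(ltW g0).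
rewrite enorm_leP ?sqrtr_ge0// sqr_sqrtr// in z2.
rewrite -ler_pdivlMl ?divr_gt0//; apply: (le_trans z2).
by rewrite le_eqVlt; apply/orP; left; apply/eqP; field; rewrite gt_eqF.
Qed.

End Assembly.

Unset Implicit Arguments.
Set Strict Implicit.

Theorem theorem5p3 (R : realType) (n s p : nat)
  (S : set 'cV[R]_n) (A : 'M[R]_(s, n)) (K : 'M[R]_(p, n))
  (g : 'cV[R]_s -> \bar R) (h : 'cV[R]_n -> R) (gradh : 'cV[R]_n -> 'cV[R]_n)
  (Lh : R) (f : 'cV[R]_p -> \bar R) (ell : R)
  (beta nu q delta0 theta0 eps : R)
  (x u : nat -> 'cV[R]_n) (y : nat -> 'cV[R]_p) (z : nat -> 'cV[R]_s)
  (theta delta gamma : nat -> R) (gam : R) (K0 : nat) :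
  (* ---- standing assumptions on the problem ---- *)
  S !=set0 -> convex_set_cv S -> compact S ->
  proper_fun g -> convex_fun g -> lsc_fun g ->
  0 <= Lh ->
  (exists O : set 'cV[R]_n, open O /\ S `<=` O /\
     (forall v, O v -> is_grad h v (gradh v)) /\
     (forall v w, O v -> O w -> enorm (gradh v - gradh w) <= Lh * enorm (v - w))) ->
  proper_fun f -> convex_fun f -> lsc_fun f ->
  (forall v, S v -> interior (edom f) (K *m v)) ->
  (forall v, S v -> (0 < f (K *m v))%E) ->
  (exists v, S v /\ edom g (A *m v)) ->
  (0 < ereal_inf [set (g (A *m v) + (h v)%:E)%E | v in S])%E ->
  (forall v, S v -> subdiff g (A *m v) !=set0) ->
  0 < ell ->
  (forall v, S v -> dist_set 0 (subdiff g (A *m v)) <= ell) ->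
  (* ---- parameters of the algorithm ---- *)
  0 < beta < 2 -> 0 < nu -> 0 < q < 1 -> 0 < delta0 -> 0 < theta0 -> 0 < eps ->
  (* ---- the iterates are generated by the algorithm ---- *)
  S (x 0) -> gamma 0 = 1 -> delta 0 = delta0 -> theta 0 = theta0 ->
  (forall k, subdiff f (K *m x k) (y k.+1)) ->
  (forall k, is_proj S (u k + (theta k / delta k) *: (K^T *m y k.+1)
                        - (delta k)^-1 *: gradh (x k)
                        - (delta k)^-1 *: (A^T *m z k)) (x k.+1)) ->
  (forall k, u k.+1 = (1 - beta) *: u k + beta *: x k.+1) ->
  (forall k, exists jk : nat,
     is_prox (fconj g) (gamma k * q ^+ jk)^-1
             ((gamma k * q ^+ jk)^-1 *: (A *m x k.+1)) (z k.+1) /\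
     (theta k.+1)%:E = PsiQ A K g h f S (x k.+1) (z k.+1) (u k.+1)
                         (delta k) (gamma k * q ^+ jk) /\
     0 < theta k.+1 /\
     (forall (j : nat) (zj : 'cV[R]_s), (j < jk)%N ->
        is_prox (fconj g) (gamma k * q ^+ j)^-1
                ((gamma k * q ^+ j)^-1 *: (A *m x k.+1)) zj ->
        ~ (0 < PsiQ A K g h f S (x k.+1) zj (u k.+1) (delta k) (gamma k * q ^+ j))%E) /\
     gamma k.+1 = (if Num.min (eps / (gamma k * q ^+ jk))
                              (Num.sqrt (2 * eps / (gamma k * q ^+ jk)))
                      < enorm (z k.+1)
                   then gamma k * q ^+ jk * q else gamma k * q ^+ jk) /\
     delta k.+1 = 2 * nu + Lh + 2 * opnorm A ^+ 2 / gamma k.+1) ->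
  (* ---- eventually constant gamma_k, delta_k ---- *)
  0 < gam ->
  (forall k, (K0 <= k)%N ->
     gamma k = gam /\ delta k = 2 * nu + Lh + 2 * opnorm A ^+ 2 / gam /\
     enorm (z k.+1) <= Num.min (eps / gam) (Num.sqrt (2 * eps / gam))) ->
  (* ---- conclusions ---- *)
  let dlt := 2 * nu + Lh + 2 * opnorm A ^+ 2 / gam in
  let Pi := fun xx zz uu => PsiQ A K g h f S xx zz uu dlt gam in
  (* (i) and (iii) *)
  (exists thb : R,
     (forall k, (K0.+1 <= k)%N -> (theta k)%:E = Pi (x k) (z k) (u k)) /\
     (forall k, (K0.+1 <= k)%N -> theta k.+1 <= theta k) /\
     0 <= thb /\ theta @ \oo --> thb /\
     (forall xb yb zb ub,
        cluster ((fun k => (x k, y k, z k, u k)) @ \oo) (xb, yb, zb, ub) ->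
        Pi xb zb ub = thb%:E)) /\
  (* (ii) *)
  (exists B : R, forall k,
     enorm (x k) <= B /\ enorm (y k) <= B /\ enorm (z k) <= B /\ enorm (u k) <= B) /\
  (* (iv a) *)
  ((forall w, dist_set w [set A *m v | v in S] <= eps -> interior (edom g) w) ->
   exists kappa : R, 0 < kappa /\
     compact [set w | dist_set w [set A *m v | v in S] <= eps] /\
     (forall w w', dist_set w [set A *m v | v in S] <= eps ->
                   dist_set w' [set A *m v | v in S] <= eps ->
        (`|g w - g w'| <= (kappa * enorm (w - w'))%:E)%E) /\
     (forall xb, cluster (x @ \oo) xb ->
        lifted_stationary A K g h gradh f S (2 * kappa * eps)
                          ((2 * kappa + 1) * eps) xb)) /\
  (* (iv b) *)
  (forall (Lg : R) (gradg : 'cV[R]_s -> 'cV[R]_s),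
     (forall w, edom g w) -> 0 < Lg ->
     (forall w, is_grad (fun w' => fine (g w')) w (gradg w)) ->
     (forall w w', enorm (gradg w - gradg w') <= Lg * enorm (w - w')) ->
     forall xb, cluster (x @ \oo) xb ->
       lifted_stationary A K g h gradh f S (Lg * eps ^+ 2 / 2)
                         (Lg * eps ^+ 2 / 2 + eps) xb) /\
  (* (v) *)
  ((fun k => ediv ((inner (K *m x k.+1) (y k.+1))%:E - fconj f (y k.+1))%E
                  (f (K *m x k))) @ \oo --> 1%E) /\
  (forall m M : R, 0 < m -> 0 < M ->
     (m%:E < ereal_inf [set f (K *m x k) | k in [set k : nat | (1 <= k)%N]])%E ->
     (ereal_sup [set f (K *m x k) | k in [set k : nat | (1 <= k)%N]] <= M%:E)%E ->
     exists K1 : nat, (K0.+1 <= K1)%N /\ forall k, (K1 <= k)%N ->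
       (0 < m%:E)%E /\
       (m%:E <= (inner (K *m x k) (y k))%:E - fconj f (y k))%E /\
       ((inner (K *m x k) (y k))%:E - fconj f (y k) <= f (K *m x k))%E /\
       (f (K *m x k) <= M%:E)%E).
Proof.
move=> [s0 Ss0] Sconv Scomp pg cg lg Lh0 [D [_ [SO [Oh OL]]]] pf cf lf Kdom fpos _ _
  gsub _ _ beta02 nu0 q01 _ th00 eps0 Sx0 _ _ theta0E ysub xproj urec alg gam0 tail dlt Pi.
have [zp zpP] : exists zp : 'cV[R]_s -> 'cV[R]_s,
    forall a, subdiff g (a - gam *: zp a) (zp a).
  by apply: prox_map_exists => //; have [v] := gsub _ Ss0; exists (A *m s0), v.
have [m0 [M0 [m00 Fbnd]]] := denominator_bounds Scomp pf cf lf Kdom fpos.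
have xS k : S (x k) by case: k => [|k] //; have [] := xproj k.
have thp k : 0 <= theta k.
  case: k => [|k]; first by rewrite theta0E ltW.
  by have [j [_ [_ [/ltW]]]] := alg k.
have algN k : (K0 <= k)%N -> z k.+1 = zp (A *m x k.+1) /\
    (theta k.+1)%:E = Pi (x k.+1) (z k.+1) (u k.+1).
  move=> Kk; have [j [jprox [jth [_ [_ [jgam _]]]]]] := alg k.
  have [gk [dk _]] := tail k Kk; have [gk1 _] := tail k.+1 (leqW Kk).
  (* [gamma k] and [gamma k.+1] both equal [gam], so the accepted trial parameter is [gam];
     [theta k.+1] is formed with [delta k], which is already [dlt]. *)
  rewrite gk1 !gk in jgam; rewrite gk (backtrack_trivial gam0 q01 jgam) dk in jprox jth.
  by split; [exact: prox_conj_eq jprox | rewrite jth].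
have zN k : (K0.+1 <= k)%N -> z k = zp (A *m x k).
  by case: k => // k Kk; have [] := algN k Kk.
have thPi k : (K0.+1 <= k)%N -> (theta k)%:E = Pi (x k) (z k) (u k).
  by case: k => // k Kk; have [] := algN k Kk.
have Fgt0 v : S v -> 0 < fine (f (K *m v)) by exact: F_gt0 m00 Fbnd v.
have thE k : (K0.+1 <= k)%N -> theta k * fine (f (K *m x k)) =
    envelope g gam zp (A *m x k) + h (x k) + dlt / 2 * inner (x k - u k) (x k - u k).
  move=> Kk; have := thPi k Kk; rewrite zN// /Pi envelope_PsiQ// => -[->].
  by rewrite divfK// gt_eqF// Fgt0.
have xprojN k : (K0.+1 <= k)%N ->
  is_proj S (u k + (theta k / dlt) *: (K^T *m y k.+1) - dlt^-1 *: gradh (x k)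
             - dlt^-1 *: (A^T *m zp (A *m x k))) (x k.+1).
  move=> Kk; have [_ [dk _]] := tail k (ltnW Kk).
  by have := xproj k; rewrite dk zN.
have [thb thb0 thc] := theta_cvg Sconv pg gam0 zpP SO Oh OL pf Kdom nu0 Lh0 beta02
  xS thp ysub urec xprojN thE m00 Fbnd.
have zbound k : (K0.+1 <= k)%N ->
    enorm (z k) <= Num.min (eps / gam) (Num.sqrt (2 * eps / gam)).
  by case: k => // k Kk; have [_ []] := tail k Kk.
have zlim phi xb : (forall k, (k <= phi k)%N) -> (x \o phi) @ \oo --> xb ->
    z (phi k) @[k --> \oo] --> zp (A *m xb).
  move=> phik xphi.
  have zc : zp (A *m x (phi k)) @[k --> \oo] --> zp (A *m xb).
    by apply: (prox_map_cvg pg gam0 zpP); exact: cvg_mulmx.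
  apply: (cvg_near_eq zc); near=> k; apply: zN; apply: leq_trans (phik k).
  by near: k; exact: nbhs_infty_ge.
(* The common part of (iv a) and (iv b): only the passage to an approximate subgradient at [a]
   depends on the regularity of [g]. The distance clause records that [a] comes from A(S). *)
have stationary e1 e2 : (forall a, edom g a -> forall ra, g a = ra%:E ->
     dist_set a [set A *m v | v in S] <= 0 ->
     enorm (gam *: zp a) <= eps -> gam / 2 * inner (zp a) (zp a) <= eps ->
     esubdiff g e1 a (zp a) /\ `|envelope g gam zp a - ra| <= e2) ->
   forall xb, cluster (x @ \oo) xb -> lifted_stationary A K g h gradh f S e1 e2 xb.
  move=> He xb /cluster_subseq[phi phik xphi].
  have Sxb := limit_in Scomp xS xphi.
  have ulim := anchor_limit Sconv pg gam0 zpP SO Oh OL pf Kdom nu0 Lh0 beta02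
    xS thp ysub urec xprojN thE m00 Fbnd phik xphi.
  have := limit_value Scomp pg gam0 zpP SO Oh pf cf Kdom xS thE phik xphi thc ulim.
  rewrite subrr inner0r mulr0 addr0 => thbE.
  have [yb [ybf wS]] := limit_stationary Sconv Scomp pg gam0 zpP SO Oh OL pf cf Kdom
    nu0 Lh0 beta02 xS thp ysub urec xprojN thE m00 Fbnd phik xphi thc.
  have zb : enorm (zp (A *m xb)) <= Num.min (eps / gam) (Num.sqrt (2 * eps / gam)).
    have L : enorm (z (phi k)) @[k --> \oo] --> enorm (zp (A *m xb)).
      by apply: cvg_enorm; exact: zlim.
    have Rc : (fun _ : nat => Num.min (eps / gam) (Num.sqrt (2 * eps / gam))) @ \oo -->
      Num.min (eps / gam) (Num.sqrt (2 * eps / gam)) by exact: cvg_cst.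
    apply: (ler_cvg_to L Rc); near=> k; apply: zbound; apply: leq_trans (phik k).
    by near: k; exact: nbhs_infty_ge.
  have [ze zze] := dual_step_bounds gam0 eps0 zb.
  have [v0 v0g] := gsub _ Sxb; have [ra raE] := subdiff_dom pg v0g.
  have [||||zsub err] := He (A *m xb) _ ra raE.
  - by rewrite /edom /= raE ltey.
  - have AS : [set A *m v | v in S] (A *m xb) by exists xb.
    by have := dist_set_le (A *m xb) AS; rewrite subrr enorm0.
  - exact: ze.
  - exact: zze.
  (* By [thbE] this value is the envelope plus [h] at the limit, so its error is that of the
     envelope alone. *)
  exists (thb * fine (f (K *m xb))); split.
    rewrite raE -EFinD !lee_fin thbE.
    by move: err; rewrite ler_norml; lra.
  exists (zp (A *m xb)), (thb *: (K^T *m yb) - gradh xb - A^T *m zp (A *m xb)), yb.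
  split=> //; split=> //; split=> //.
  have -> : A^T *m zp (A *m xb) + gradh xb
    + (thb *: (K^T *m yb) - gradh xb - A^T *m zp (A *m xb)) = thb *: (K^T *m yb).
    by apply/colP => i; rewrite !mxE; ring.
  by rewrite scalerA [_ * thb]mulrC subrr.
split; last split; last split; last split; last split.
- exists thb; split=> //; split; last split=> //.
    exact: (theta_nonincreasing Sconv pg gam0 zpP SO Oh OL pf Kdom nu0 Lh0 beta02
      xS thp ysub urec xprojN thE m00 Fbnd).
  split=> // xb yb zb ub /cluster_subseq[phi phik Wphi].
  have [xyzphi uphi] := cvg_pair_components Wphi.
  have [xyphi zphi] := cvg_pair_components xyzphi.
  have [xphi _] := cvg_pair_components xyphi.
  have Sxb := limit_in Scomp xS xphi.
  have -> : zb = zp (A *m xb).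
    exact: (cvg_unique (@norm_hausdorff _ 'cV[R]_s) zphi (zlim phi xb phik xphi)).
  rewrite /Pi envelope_PsiQ//.
  rewrite -(limit_value Scomp pg gam0 zpP SO Oh pf cf Kdom xS thE phik xphi thc uphi).
  by rewrite mulfK// gt_eqF// Fgt0.
- have anc := anchor_cvg0 Sconv pg gam0 zpP SO Oh OL pf Kdom nu0 Lh0 beta02
    xS thp ysub urec xprojN thE m00 Fbnd.
  have [Bx HBx] : exists B, forall k, enorm (x k) <= B.
    by have [B HB] := compact_enorm_bounded Scomp; exists B => k; exact: HB.
  have [By HBy] := y_bounded Scomp pf cf Kdom xS ysub.
  have [Bz HBz] : exists B, forall k, enorm (z k) <= B.
    apply: eventually_bounded; near=> k; apply: zbound.
    by near: k; exact: nbhs_infty_ge.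
  have [Bu HBu] : exists B, forall k, enorm (x k - u k) <= B.
    apply: (@eventually_bounded _ _ 1); have := cvgr_le 0 anc 1 ltr01.
    exact.
  (* [y 0] is produced by no step and enters separately; [u k] is controlled through [x k - u k]. *)
  pose B := Num.max (Num.max Bx (Num.max By (enorm (y 0%N)))) (Num.max Bz (Bx + Bu)).
  exists B => k; rewrite /B !le_max HBx HBz !orbT; split=> //; split.
    by case: k => [|k]; rewrite ?lexx ?HBy ?orbT.
  split=> //; rewrite -[u k](subKr (x k)).
  have -> : enorm (x k - (x k - u k)) <= Bx + Bu.
    by rewrite (le_trans (enormD _ _))// enormN lerD.
  by rewrite !orbT.
- move=> Kint.
  have AS0 : [set A *m v | v in S] !=set0 by exists (A *m s0), s0.
  have ASc := KS_compact (K := A) Scomp.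
  have Kc := dist_set_compact (r := eps) AS0 ASc.
  have Kd : [set w | dist_set w [set A *m v | v in S] <= eps] `<=` interior (edom g).
    by move=> w; exact: Kint.
  have [k k0 Hk] := convex_lipschitz_compact pg cg Kc Kd.
  have gfin w : dist_set w [set A *m v | v in S] <= eps -> g w = (fine (g w))%:E.
    move=> /Kint/interior_subset; rewrite /edom /=.
    by have := pg.2 w; case: (g w).
  exists k; split=> //; split=> //; split.
    move=> w w' wK w'K; rewrite (gfin w wK) (gfin w' w'K) -EFinB lee_fin.
    exact: Hk.
  apply: stationary => a _ ra raE a0 ze zze.
  apply: (prox_esubdiff_lipschitz pg gam0 zpP raE k0) => //.
  have aK : dist_set a [set A *m v | v in S] <= eps by apply: le_trans a0 (ltW eps0).
  have wK : dist_set (a - gam *: zp a) [set A *m v | v in S] <= eps.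
    apply: (le_trans (dist_set_lipschitz (a - gam *: zp a) a AS0)).
    by rewrite addrAC subrr add0r enormN; lra.
  have := Hk _ _ aK wK; rewrite raE subKr /=.
  by move=> /(le_trans (ler_norm _)).
- move=> Lg gradg gdom Lg0 gg gL; apply: stationary => a _ ra raE _ ze zze.
  exact: (prox_esubdiff_smooth pg gam0 zpP gdom Lg0 gg gL raE ze zze).
- exact: (conj_ratio_cvg1 Sconv Scomp pg gam0 zpP SO Oh OL pf cf Kdom nu0 Lh0 beta02
    xS thp ysub urec xprojN thE m00 Fbnd).
- move=> m M mp Mp minf supM.
  have fE k := fK_fin pf Kdom (xS k).
  (* The strict inequality below the infimum is turned into a uniform margin [d], which absorbs
     [gap] later on. *)
  have [d d0 Hd] : exists2 d : R, 0 < d & forall k, (1 <= k)%N ->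
      m + d <= fine (f (K *m x k)).
    have Hle k : (1 <= k)%N -> (ereal_inf [set f (K *m x k) | k in [set k : nat | (1 <= k)%N]]
        <= (fine (f (K *m x k)))%:E)%E.
      by move=> k1; rewrite -fE; apply: ereal_inf_lbound; exists k.
    move: minf Hle; case: (ereal_inf _) => [r| |] //.
      rewrite lte_fin => mr Hle; exists (r - m) => [|k /Hle]; first by rewrite subr_gt0.
      by rewrite lee_fin addrC subrK.
    by move=> _ Hle; exists 1 => // k /Hle.
  have gap0 := gap_cvg0 Sconv Scomp pg gam0 zpP SO Oh OL pf cf Kdom nu0 Lh0 beta02
    xS thp ysub urec xprojN thE m00 Fbnd.
  have /cvgrPdist_lt/(_ d d0)[N1 _ HN1] := gap0.
  (* At [k = j.+1] the expression involves [x j] and [gap j], so both [N1 <= j] and [1 <= j] are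
     required. *)
  exists (maxn K0.+1 (maxn N1.+1 2)); split; first by rewrite leq_maxl.
  case=> [|j]; first by rewrite !geq_max.
  rewrite !geq_max !ltnS => /andP[_ /andP[N1j j1]].
  rewrite (conj_gapE pf Kdom xS ysub); split; first by rewrite lte_fin.
  split.
    rewrite lee_fin; have := HN1 _ N1j; have := Hd j j1.
    by rewrite /= sub0r normrN ltr_norml; lra.
  split; first by rewrite (fE j.+1) lee_fin; exact: (gap_le pf Kdom xS ysub).
  by apply: le_trans supM; apply: ereal_sup_ubound; exists j.+1.
Unshelve. all: by end_near. Qed.
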